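(* Let $n\ge1$ and let $D_M\geq 1$ be an integer. Let $H\in\mathbb{R}^{n\times n}$ be symmetric with $H_mI\le H\le H_MI$ for known positive scalars $H_m,H_M$. Let $\sigma_0>0$; suppose that $\theta^*\in\mathbb{R}^n$ is uncertain from a known ball with radius $\sigma_0$, its components satisfying $\theta_i^*\in[\underline\theta_i^*,\overline\theta_i^*]$, $i=1,\dots,n$, with $\sum_{i=1}^n(\overline\theta_i^*-\underline\theta_i^* )^2=\sigma_0^2$, and that $|Q^*-Q_0|\le\Delta_Q$ with known $Q_0\in\mathbb{R}$ and $\Delta_Q>0$. Let $a_1,\dots,a_n>0$ and $k>0$. Consider the estimation error system (classical extremum seeking) $$\tilde\theta(j+1)=\tilde\theta(j)-\varepsilon kM(j)\Big[Q^*+\tfrac12\big|\tilde\theta(j-D(j))+S(j-D(j))\big|_H^2\Big],\quad j\ge D_M,$$ with $\tilde\theta(j)=\tilde\theta(0)$ and $|\tilde\theta(j)|\le\sigma_0$ for $0\le j\le D_M$, where $D(j)\in\mathbb{Z}$ is an unknown time-varying delay with $0\le D(j)\le D_M$ for all $j\ge0$, and $M,S$ are defined in the context. Let $\sigma>\sigma_0$. Suppose there exists $\varepsilon^*>0$ such that (a) $nD_M\lfloor\tfrac{1}{\sqrt{\varepsilon^*}}\rfloor\ge 2n+1$; (b) $\varepsilon^*kH_m<2$; (c) $\displaystyle(\sigma_0+\sqrt{\varepsilon^*}\Delta_G)|1-\varepsilon^*kH_m|^{-D_M}+\sqrt{\varepsilon^*}\Delta_G+\frac{(\sqrt{\varepsilon^*})^3\Delta_Y}{1-|1-\varepsilon^*kH_m|}<\sigma,$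 where $\Delta_G,\Delta_Y$ are defined in the context. Then for all $\varepsilon\in(0,\varepsilon^*]$ the solutions satisfy $|\tilde\theta(j)|<\sigma$ for $j\ge D_M$ and are exponentially attracted to the set $$\Theta=\Big\{\tilde\theta\in\mathbb{R}^n:\ |\tilde\theta|<\sqrt\varepsilon\Big(\Delta_G+\frac{\varepsilon\Delta_Y}{1-|1-\varepsilon kH_m|}\Big)\Big\}$$ with decay rate $|1-\varepsilon kH_m|$. Moreover, for any $D_M\geq 1$ and $\sigma_0>0$, inequalities (a), (b), (c) are always feasible for small enough $\varepsilon^*,k$ and appropriate $\sigma>\sigma_0$.
   Context: Notation: $|\cdot|$ is the Euclidean norm; $|x|_P^2=x^TPx$; $\lfloor\cdot\rfloor$ is the floor; time $j$ runs over nonnegative integers. ''Exponentially attracted to $\Theta$ with decay rate $r$'' means that the distance from $\tilde\theta(j)$ to $\Theta$ is bounded by a constant times $r^j$. Origin of the system: the map $Q(\theta)=Q^*+\frac12|\theta-\theta^*|_H^2$ on $\mathbb{R}^n$ with unknown $\theta^*,Q^*$ is measured with delay as $y(j)=Q(\theta(j-D(j)))$; the estimate obeys $\hat\theta(j+1)=\hat\theta(j)-\varepsilon kM(j)y(j)$ for $j\ge D_M$, $\hat\theta(j)=\theta(0)$ for $0\le j\le D_M$; and $\tilde\theta(j)=\hat\theta(j)-\theta^*$. Dithers: for $\varepsilon>0$, $T=\max\{nD_M\lfloor1/\sqrt\varepsilon\rfloor,\,2n+1\}$, $\omega_i=2\pi i/T$, $S(j)=[S_1(j),\dots,S_n(j)]^T$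 with $S_i(j)=a_i\sin(\omega_ij)$, $M(j)=[M_1(j),\dots,M_n(j)]^T$ with $M_i(j)=\frac{2}{a_i}\sin(\omega_ij)$. Constants $\bar\rho_l$ (with $\varepsilon$ below taken equal to $\varepsilon^*$): $\bar\rho_1=0.19245\,nD_MkH_M\Big[\sum_{i=1}^n\frac1i+\sum_{1\le i\ne l\le n}\frac{a_l}{a_i}\big(\frac{1}{|i-l|}+\frac{1}{i+l}\big)\Big]$, $\bar\rho_2=0.3849\,nD_Mk\sum_{i=1}^n\frac{1}{ia_i}$, $\bar\rho_3=kH_M\big(\sum_{s=1}^na_s^2\big)\sqrt{\sum_{i=1}^n\frac{c_i^2}{a_i^2}}$, $\bar\rho_4=0.19245\,nD_Mk\sum_{i=1}^n\frac{1}{ia_i}$, where $$c_i=\frac{(nD_M+\sqrt\varepsilon)(2nD_M+\sqrt\varepsilon)}{12}+\frac{\sqrt\varepsilon(\sqrt\varepsilon+nD_M)+D_M^2n^2\big(1+\frac{1}{3.3072\pi i}\big)}{3.3072\,\pi i}.$$ Let $A=\sqrt{\sum_{i=1}^na_i^2}$ and $B=\sqrt{\sum_{i=1}^na_i^{-2}}$. Then $$\Delta_G=\bar\rho_1\sigma+\bar\rho_2(Q_0+\Delta_Q)+\bar\rho_3+\bar\rho_4\sigma^2H_M,\qquad \sigma_y=\tfrac{H_M}{2}(\sigma+A)^2,$$ $$\Delta=2k[\sigma_y+Q_0+\Delta_Q]B,$$ $$\bar\Delta_{out}=2kD_MH_MB\,[\sigma+A]\Big[\sqrt{\varepsilon^*}\Delta+\frac{2\pi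 A}{(1-\sqrt{\varepsilon^*})D_M}\Big[\frac{\pi\sqrt{\varepsilon^*}}{(1-\sqrt{\varepsilon^*})D_M}+1\Big]\Big],$$ $$\Delta_Y=kH_M\Delta_G+\bar\rho_1(\Delta+\sqrt{\varepsilon^*}\bar\Delta_{out})+2\bar\rho_4\sigma H_M(\Delta+\sqrt{\varepsilon^*}\bar\Delta_{out})+\bar\Delta_{out}+\varepsilon^*\bar\rho_4H_M(\Delta+\sqrt{\varepsilon^*}\bar\Delta_{out})^2.$$
   Formalization: The bound |Q*| ≤ Q_0+Δ_Q is additionally assumed (automatic if Q_0 ≥ 0; for very negative Q_0 the claim fails, as Δ_G<0 and Θ can be empty), and (c) is read with √ε* ≠ 1 and ε*kH_m ≠ 1 so that its divisions make sense. *)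

(* Defs.v *)
From HB Require Import structures.
From mathcomp Require Import all_boot all_order all_algebra.
From mathcomp Require Import all_classical all_reals all_analysis.

Set Implicit Arguments.
Unset Strict Implicit.
Unset Printing Implicit Defensive.

Import Order.TTheory GRing.Theory Num.Theory.

Local Open Scope classical_set_scope.
Local Open Scope ring_scope.

Section EuclideanSpace.
Context {R : realType} {n : nat}.

(* The norm MathComp-Analysis puts on matrices is the sup norm, hence these
   Euclidean versions. *)
Definition enorm (x : 'cV[R]_n) : R := Num.sqrt (\sum_i x i 0 ^+ 2).

Definition wnorm2 (P : 'M[R]_n) (x : 'cV[R]_n) : R := (x^T *m P *m x) 0 0.

Definition loewner_le (P Q : 'M[R]_n) : Prop :=
  forall x : 'cV[R]_n, 0 <= wnorm2 (Q - P) x.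

(* Extended-real valued, so that the distance to the empty set is +oo. *)
Definition edist_set (x : 'cV[R]_n) (Z : set 'cV[R]_n) : \bar R :=
  ereal_inf [set (enorm (x - z))%:E | z in Z].

Definition exp_attracted (x : nat -> 'cV[R]_n) (Z : set 'cV[R]_n) (r : R) :
    Prop :=
  exists C : R, forall j : nat, (edist_set (x j) Z <= (C * r ^+ j)%:E)%E.

End EuclideanSpace.

(* Components are indexed by i : 'I_n = {0, ..., n-1}; the index "i" of a
   formula with i = 1, ..., n is i.+1 below. *)
Section ExtremumSeeking.
Context {R : realType} {n : nat}.

(* The decimals 0.19245, 0.3849 and 3.3072, split to keep numerals small. *)
Definition d0_19245 : R := 192 / 10 ^+ 3 + 45 / 10 ^+ 5.
Definition d0_3849 : R := 38 / 10 ^+ 2 + 49 / 10 ^+ 4.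
Definition d3_3072 : R := 33 / 10 + 72 / 10 ^+ 4.

Variables (DM : nat) (k : R) (a : 'cV[R]_n).

Definition floor_inv_sqrt (eps : R) : int := Num.floor (1 / Num.sqrt eps).

Definition period (eps : R) : R :=
  Num.max (n%:R * DM%:R * (floor_inv_sqrt eps)%:~R) (2 * n%:R + 1).

Definition omega (eps : R) (i : 'I_n) : R := 2 * pi * i.+1%:R / period eps.

Definition ditherS (eps : R) (j : nat) : 'cV[R]_n :=
  \col_i (a i 0 * sin (omega eps i * j%:R)).

Definition ditherM (eps : R) (j : nat) : 'cV[R]_n :=
  \col_i (2 / a i 0 * sin (omega eps i * j%:R)).

(* [j - D j] is a natural-number subtraction; it is only used for
   [D j <= DM <= j], where it is not truncated. *)
Definition es_solution (H : 'M[R]_n) (Qs eps : R) (D : nat -> nat)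
    (th : nat -> 'cV[R]_n) : Prop :=
  (forall j : nat, (j <= DM)%N -> th j = th 0%N) /\
  (forall j : nat, (DM <= j)%N ->
     th j.+1 = th j - (eps * k
       * (Qs + 1 / 2 * wnorm2 H (th (j - D j)%N + ditherS eps (j - D j)%N)))
       *: ditherM eps j).

Variables (Hm HM sigma Q0 DQ : R).

Definition normA : R := Num.sqrt (\sum_i a i 0 ^+ 2).
Definition normB : R := Num.sqrt (\sum_i (a i 0) ^- 2).

Definition rho1 : R :=
  d0_19245 * n%:R * DM%:R * k * HM *
  (\sum_(i < n) 1 / i.+1%:R +
   \sum_(i < n) \sum_(l < n | i != l)
     a l 0 / a i 0 * (1 / `|i.+1%:R - l.+1%:R| + 1 / (i.+1%:R + l.+1%:R))).

Definition rho2 : R :=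
  d0_3849 * n%:R * DM%:R * k * \sum_(i < n) 1 / (i.+1%:R * a i 0).

Definition coef_c (eps : R) (i : 'I_n) : R :=
  let se := Num.sqrt eps in
  let nD : R := n%:R * DM%:R in
  let q : R := d3_3072 * pi * i.+1%:R in
  (nD + se) * (2 * nD + se) / 12
  + (se * (se + nD) + DM%:R ^+ 2 * n%:R ^+ 2 * (1 + 1 / q)) / q.

Definition rho3 (eps : R) : R :=
  k * HM * (\sum_s a s 0 ^+ 2)
  * Num.sqrt (\sum_i coef_c eps i ^+ 2 / a i 0 ^+ 2).

Definition rho4 : R :=
  d0_19245 * n%:R * DM%:R * k * \sum_(i < n) 1 / (i.+1%:R * a i 0).

Definition DeltaG (eps : R) : R :=
  rho1 * sigma + rho2 * (Q0 + DQ) + rho3 eps + rho4 * sigma ^+ 2 * HM.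

Definition sigma_y : R := HM / 2 * (sigma + normA) ^+ 2.

Definition Delta : R := 2 * k * (sigma_y + Q0 + DQ) * normB.

Definition DeltaOut (eps : R) : R :=
  let se := Num.sqrt eps in
  2 * k * DM%:R * HM * normB * (sigma + normA) *
  (se * Delta
   + 2 * pi * normA / ((1 - se) * DM%:R)
     * (pi * se / ((1 - se) * DM%:R) + 1)).

Definition DeltaY (eps : R) : R :=
  let E := Delta + Num.sqrt eps * DeltaOut eps in
  k * HM * DeltaG eps + rho1 * E + 2 * rho4 * sigma * HM * E
  + DeltaOut eps + eps * rho4 * HM * E ^+ 2.

Definition condA (eps : R) : Prop :=
  (n%:Z * DM%:Z * floor_inv_sqrt eps >= 2 * n%:Z + 1)%R.

Definition condB (eps : R) : Prop := eps * k * Hm < 2.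

(* The first two conjuncts say that the divisions by [1 - sqrt eps] (in
   [DeltaOut]) and by powers of [`|1 - eps k Hm|] are meaningful, since
   division by 0 returns 0 here.  The remaining denominator is nonzero as soon
   as [condB] holds. *)
Definition condC (sigma0 eps : R) : Prop :=
  [/\ 1 - Num.sqrt eps != 0, 1 - eps * k * Hm != 0 &
   (sigma0 + Num.sqrt eps * DeltaG eps) * `|1 - eps * k * Hm| ^- DM
   + Num.sqrt eps * DeltaG eps
   + Num.sqrt eps ^+ 3 * DeltaY eps / (1 - `|1 - eps * k * Hm|) < sigma].

(* [DeltaG] and [DeltaY] are evaluated at the fixed bound [eps_s], while the
   other occurrences of the parameter are the actual [eps <= eps_s]. *)
Definition Theta (eps_s eps : R) : set 'cV[R]_n :=
  [set x | enorm x < Num.sqrt eps *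
     (DeltaG eps_s + eps * DeltaY eps_s / (1 - `|1 - eps * k * Hm|))].

End ExtremumSeeking.

Arguments period {R} n DM eps.
Arguments condA {R} n DM eps.

(* Main.v *)
Require Import Defs.
From HB Require Import structures.
From mathcomp Require Import all_boot all_order all_algebra.
From mathcomp Require Import all_classical all_reals all_analysis.
From mathcomp Require Import ring lra.
Import Order.TTheory GRing.Theory Num.Theory.
Import numFieldNormedType.Exports.
Local Open Scope ring_scope.

Set Implicit Arguments.
Unset Strict Implicit.
Unset Printing Implicit Defensive.

(** The proof is a discrete averaging argument. With P, W, V explicit bounded
    sums of the zero-mean signals M, M S^T - I and |S|_H^2 M / 2, the change of
    variable z = th + eps k [(Q* + |th|_H^2 / 2) P + W H th + V] turns the
    recursion into z(j+1) = (I - eps k H) z(j) + O(eps^(3/2)), a contraction of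
    rate 1 - eps k Hm, while |z - th| <= sqrt eps DeltaG.

    Condition (c) is used twice more. Since DeltaY >= DeltaOut, its last term
    forces sqrt eps* < 1/13, so the period is at least 13 n, all the frequencies
    occurring in P, W, V are small and the sums are bounded by the elementary
    inequality sin (pi y) >= 3 y on [0, 1/6]; this leaves room for the rounding
    in the constants 0.19245 and 0.3849. Since DeltaG >= rho1 sigma, it also
    forces eps* k HM < 1, so that I - eps k H is positive and has norm at most
    1 - eps k Hm. *)

(** * Quadratic forms and the Euclidean norm *)

(** The powers of eps come from the period. T is about n DM / sqrt eps and a bounded sum of dithers
    is of order T, so eps times such a sum is only O(sqrt eps). A delay of at most DM steps turns
    the phase of a dither by O(sqrt eps) and moves the state by O(eps); the output is thus wrong by
    O(sqrt eps), and its product with the gain eps is the eps^(3/2). Dividing by 1 - r, which is of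
    order eps, returns O(sqrt eps).

    All frequencies are integer multiples of 2 pi / T, so combinations of them can vanish. A product
    of three sines then leaves sin 0 = 0, and a product of two leaves exactly the identity matrix,
    so every primitive stays bounded.

    The obstacle is circularity: the corrections and the increments are controlled only while the
    state is in the ball of radius sigma, which is what has to be proved. Each step therefore
    advances the time of the correction first, at the old state, and moves the state afterwards.

    The constants are frozen at eps*, while the system runs with eps; condition (c) passes to eps
    because, after the powers of eps cancel, its error terms grow with sqrt eps. *)

Section BilinearForms.
Context {R : realType} {n : nat}.
Implicit Types (B : 'M[R]_n) (u v w : 'cV[R]_n).

Definition bform B u v : R := (u^T *m B *m v) 0 0.

Lemma wnorm2E B u : wnorm2 B u = bform B u u. Proof. by []. Qed.

Lemma bformDl B u v w : bform B (u + v) w = bform B u w + bform B v w.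
Proof. by rewrite /bform linearD /= !mulmxDl mxE. Qed.

Lemma bformDr B u v w : bform B w (u + v) = bform B w u + bform B w v.
Proof. by rewrite /bform mulmxDr mxE. Qed.

Lemma bformZl B c u w : bform B (c *: u) w = c * bform B u w.
Proof. by rewrite /bform linearZ /= -!scalemxAl mxE. Qed.

Lemma bformZr B c u w : bform B w (c *: u) = c * bform B w u.
Proof. by rewrite /bform -scalemxAr mxE. Qed.

Lemma bformC B u v : B^T = B -> bform B u v = bform B v u.
Proof.
move=> sB; rewrite /bform -[in LHS](trmxK (u^T *m B *m v)) [LHS]mxE.
by rewrite !trmx_mul trmxK sB mulmxA.
Qed.

Lemma bformE B u v : bform B u v = \sum_l \sum_m B l m * u l 0 * v m 0.
Proof.
rewrite /bform mxE exchange_big /=; apply: eq_bigr => m _.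
rewrite mxE mulr_suml; apply: eq_bigr => l _.
by rewrite mxE; ring.
Qed.

Lemma bform_mulr B u v : bform 1%:M u (B *m v) = bform B u v.
Proof. by rewrite /bform mulmx1 mulmxA. Qed.

(** [B] is only semidefinite, so the usual division by [bform B v v] may fail. If that value is 0,
    the quadratic [q] is affine in [t], and the chosen point reduces it to [- bform B u v ^+ 2];
    otherwise the usual minimiser, cleared of its denominator, is inserted. *)
Lemma bform_CS B u v : B^T = B -> (forall w, 0 <= wnorm2 B w) ->
  bform B u v ^+ 2 <= bform B u u * bform B v v.
Proof.
move=> sB pB.
have q (s t : R) : 0 <= s ^+ 2 * bform B u u + 2 * s * t * bform B u v
    + t ^+ 2 * bform B v v.
  have := pB (s *: u + t *: v).
  rewrite wnorm2E !(bformDl, bformDr, bformZl, bformZr) (bformC v u sB).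
  by congr (0 <= _); ring.
have := pB v; rewrite wnorm2E le_eqVlt => /orP[/eqP v0|v_gt0].
  have := q (bform B u v) (- (bform B u u + 1) / 2).
  rewrite -v0 !mulr0 addr0.
  have -> : bform B u v ^+ 2 * bform B u u +
     2 * bform B u v * (- (bform B u u + 1) / 2) * bform B u v
     = - bform B u v ^+ 2 by field.
  by rewrite oppr_ge0.
have := q (bform B v v) (- bform B u v).
have -> : bform B v v ^+ 2 * bform B u u +
  2 * bform B v v * - bform B u v * bform B u v +
  (- bform B u v) ^+ 2 * bform B v v
  = bform B v v * (bform B u u * bform B v v - bform B u v ^+ 2) by ring.
by rewrite pmulr_rge0 // subr_ge0.
Qed.

Lemma enorm_ge0 u : 0 <= enorm u. Proof. exact: sqrtr_ge0. Qed.
Hint Resolve enorm_ge0 : core.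

Lemma sqr_enorm u : enorm u ^+ 2 = bform 1%:M u u.
Proof.
rewrite sqr_sqrtr; last by apply: sumr_ge0 => i _; exact: sqr_ge0.
by rewrite /bform mulmx1 mxE; apply: eq_bigr => i _; rewrite mxE.
Qed.

Lemma wnorm2_1_ge0 u : 0 <= wnorm2 1%:M u.
Proof. by rewrite wnorm2E -sqr_enorm sqr_ge0. Qed.

Lemma enorm_CS u v : bform 1%:M u v <= enorm u * enorm v.
Proof.
apply: le_trans (ler_norm _) _.
rewrite -(@ler_pXn2r _ 2) ?nnegrE ?mulr_ge0 //.
rewrite exprMn !sqr_enorm real_normK ?num_real //.
by apply: bform_CS; [exact: trmx1|exact: wnorm2_1_ge0].
Qed.

Lemma ler_enormD u v : enorm (u + v) <= enorm u + enorm v.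
Proof.
rewrite -(@ler_pXn2r _ 2) ?nnegrE ?addr_ge0 //.
rewrite sqr_enorm !(bformDl, bformDr) (bformC v u (@trmx1 _ _)) -!sqr_enorm.
by have := enorm_CS u v; nra.
Qed.

Lemma enormZ c u : enorm (c *: u) = `|c| * enorm u.
Proof.
apply/eqP; rewrite -(@eqrXn2 _ 2) ?mulr_ge0 //.
by rewrite exprMn !sqr_enorm real_normK ?num_real // bformZl bformZr expr2 mulrA.
Qed.

Lemma enormN u : enorm (- u) = enorm u.
Proof. by rewrite -scaleN1r enormZ normrN1 mul1r. Qed.

Lemma enorm0 : enorm (0 : 'cV[R]_n) = 0.
Proof. by rewrite -(scale0r (0 : 'cV[R]_n)) enormZ normr0 mul0r. Qed.

Lemma ler_enormB u v : enorm (u - v) <= enorm u + enorm v.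
Proof. by rewrite -[enorm v]enormN ler_enormD. Qed.

Lemma enorm_le_sum u : enorm u <= \sum_i `|u i 0|.
Proof.
rewrite -(@ler_pXn2r _ 2) ?nnegrE ?sumr_ge0 //.
rewrite sqr_sqrtr; last by apply: sumr_ge0 => i _; exact: sqr_ge0.
suff [] : (\sum_i u i 0 ^+ 2 <= (\sum_i `|u i 0|) ^+ 2) /\
   0 <= \sum_i `|u i 0| by [].
apply: (big_ind2 (fun x y : R => x <= y ^+ 2 /\ 0 <= y)).
- by rewrite expr0n.
- by move=> x1 x2 y1 y2 [h1 p1] [h2 p2]; split; nra.
- by move=> i _; rewrite real_normK ?num_real // lexx.
Qed.

Lemma ler_norm_enorm u i : `|u i 0| <= enorm u.
Proof.
rewrite -(@ler_pXn2r _ 2) ?nnegrE // real_normK ?num_real //.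
rewrite sqr_sqrtr; last by apply: sumr_ge0 => j _; exact: sqr_ge0.
by rewrite (bigD1 i) //= lerDl; apply: sumr_ge0 => j _; exact: sqr_ge0.
Qed.

(** A common factor is pulled out so that the remaining root has the form found in [rho3], [normA]
    and [normB]. *)
Lemma enorm_le_scale (t : R) u (f : 'I_n -> R) : 0 <= t ->
  (forall i, `|u i 0| <= t * f i) -> enorm u <= t * Num.sqrt (\sum_i f i ^+ 2).
Proof.
move=> t0 h.
rewrite -(@ler_pXn2r _ 2) ?nnegrE ?mulr_ge0 ?sqrtr_ge0 //.
rewrite exprMn !sqr_sqrtr; try by apply: sumr_ge0 => j _; exact: sqr_ge0.
rewrite mulr_sumr ler_sum // => i _; rewrite -exprMn -real_normK ?num_real //.
by rewrite -[leRHS]real_normK ?num_real // lerXn2r ?nnegrE // (le_trans (h i)) ?ler_norm.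
Qed.

Lemma enorm_delta (i : 'I_n) : enorm (delta_mx i 0 : 'cV[R]_n) = 1.
Proof.
rewrite /enorm (bigD1 i) //= big1 ?addr0; last first.
  by move=> m /negPf mi; rewrite mxE mi expr0n.
by rewrite mxE !eqxx expr1n sqrtr1.
Qed.

(** The entrywise sum, rather than an operator norm, is what can be compared with the double sum in
    [rho1]. *)
Lemma enorm_mulmx (W : 'M[R]_n) u :
  enorm (W *m u) <= (\sum_i \sum_l `|W i l|) * enorm u.
Proof.
apply: le_trans (enorm_le_sum _) _.
rewrite mulr_suml ler_sum // => i _; rewrite mxE mulr_suml.
apply: le_trans (ler_norm_sum _ _ _) _.
by rewrite ler_sum // => l _; rewrite normrM ler_wpM2l // ler_norm_enorm.
Qed.

Section Bounded.
Variables (B : 'M[R]_n) (b : R).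
Hypotheses (sB : B^T = B) (pB : forall w, 0 <= wnorm2 B w) (b_ge0 : 0 <= b)
  (Bb : forall w, wnorm2 B w <= b * enorm w ^+ 2).

Lemma ler_bform u v : `|bform B u v| <= b * enorm u * enorm v.
Proof.
rewrite -(@ler_pXn2r _ 2) ?nnegrE ?mulr_ge0 //.
rewrite real_normK ?num_real //; apply: le_trans (bform_CS u v sB pB) _.
have -> : (b * enorm u * enorm v) ^+ 2 = (b * enorm u ^+ 2) * (b * enorm v ^+ 2).
  by ring.
by apply: ler_pM; rewrite -?wnorm2E.
Qed.

(** Without eigenvalues: the square of [enorm (B *m u)] equals [bform B (B *m u) u], which
    Cauchy-Schwarz for [B] bounds by [b * enorm (B *m u) * enorm u]; one factor cancels. *)
Lemma enorm_mulmx_sym u : enorm (B *m u) <= b * enorm u.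
Proof.
have [->|n0] := eqVneq (enorm (B *m u)) 0; first by rewrite mulr_ge0.
have p : 0 < enorm (B *m u) by rewrite lt_neqAle eq_sym n0 enorm_ge0.
rewrite -(ler_pM2l p) -expr2 sqr_enorm bform_mulr.
by apply: le_trans (ler_norm _) _; rewrite mulrCA mulrA ler_bform.
Qed.

Lemma ler_mx_entry i l : `|B i l| <= b.
Proof.
have := ler_bform (delta_mx i 0) (delta_mx l 0).
rewrite !enorm_delta !mulr1; congr (`| _ | <= _).
rewrite bformE (bigD1 i) //= [X in _ + X]big1 ?addr0; last first.
  move=> m /negPf mj; rewrite big1 // => p _.
  by rewrite mxE mj mulr0 mul0r.
rewrite (bigD1 l) //= big1 ?addr0; last first.
  by move=> m /negPf mj; rewrite [X in _ * X]mxE mj mulr0.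
by rewrite !mxE !eqxx !mulr1.
Qed.

End Bounded.

Lemma wnorm2_scalar c u : wnorm2 c%:M u = c * enorm u ^+ 2.
Proof. by rewrite sqr_enorm wnorm2E /bform mul_mx_scalar mulmx1 -scalemxAl mxE. Qed.

Lemma wnorm2B (B C : 'M[R]_n) u : wnorm2 (B - C) u = wnorm2 B u - wnorm2 C u.
Proof. by rewrite /wnorm2 mulmxBr mulmxBl !mxE. Qed.

Lemma wnorm2Z c (B : 'M[R]_n) u : wnorm2 (c *: B) u = c * wnorm2 B u.
Proof. by rewrite /wnorm2 -scalemxAr -scalemxAl mxE. Qed.

Lemma wnorm2D (B : 'M[R]_n) u v : B^T = B ->
  wnorm2 B (u + v) = wnorm2 B u + 2 * bform B u v + wnorm2 B v.
Proof.
move=> sB; rewrite !wnorm2E !(bformDl, bformDr) (bformC v u sB); ring.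
Qed.

End BilinearForms.

(** * Sums of sines and cosines *)

Section Trigonometry.
Context {R : realType}.
Implicit Types (x y t nu : R) (j : nat).

Lemma sin_MVT x y : x <= y ->
  exists2 c, x <= c <= y & sin y - sin x = cos c * (y - x).
Proof.
move=> xy; have h : {within `[x, y], continuous (@sin R)}%classic.
  by apply: continuous_subspaceT => z; exact: continuous_sin.
have [c] := MVT_segment xy (fun z _ => is_derive_sin z) h.
by rewrite in_itv /= => cxy ->; exists c.
Qed.

Lemma ler_sin_dist x y : `|sin x - sin y| <= `|x - y|.
Proof.
wlog xy : x y / x <= y.
  by move=> h; case/orP: (le_total x y) => /h //; rewrite distrC (distrC x).
have [c _ e] := sin_MVT xy.
by rewrite distrC e normrM (distrC x) ler_piMl // cos_max.
Qed.

(** Concavity: the mean slope of the sine on [0, x] is a cosine at an earlier point than the one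
    giving the slope on [x, y], and the cosine decreases on [0, pi]. *)
Lemma sin_chord x y : 0 <= x <= y -> y <= pi -> x * sin y <= y * sin x.
Proof.
move=> /andP[x0 xy] ypi.
have [c /andP[c0 cx]] := sin_MVT x0; have [d /andP[xd dy]] := sin_MVT xy.
rewrite sin0 !subr0 => ed ec.
have dc : cos d <= cos c.
  have cI : c \in `[0, pi] by rewrite in_itv /=; lra.
  have dI : d \in `[0, pi] by rewrite in_itv /=; lra.
  by rewrite leNgt ltr_cos // -leNgt; lra.
have : 0 <= (y - x) * x * (cos c - cos d) by rewrite !mulr_ge0 // subr_ge0.
by rewrite -(subrK (sin x) (sin y)) ed ec; lra.
Qed.

Lemma sin_pi6 : sin (pi / 6) = 1 / 2 :> R.
Proof.
have p0 := @pi_gt0 R; set z := pi / 6.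
have s0 : 0 < sin z by apply: sin_gt0_pihalf; rewrite /z; lra.
have : sin (z + z + z) = 1.
  by rewrite -(@sin_pihalf R); congr sin; rewrite /z; field.
rewrite !sinD !cosD => e.
(* This is the triple angle equation 3 s - 4 s^3 = 1 in factored form; positivity of [sin z]
   excludes the root -1. *)
have : (sin z + 1) * (2 * sin z - 1) ^+ 2 = 0.
  have c2 := cos2Dsin2 z; move: e c2.
  set s := sin z; set c := cos z => e c2.
  have : 3 * s * (1 - s ^+ 2) - s ^+ 3 = 1.
    have -> : 1 - s ^+ 2 = c ^+ 2 by rewrite -c2; ring.
    by rewrite -[RHS]e; ring.
  by move=> e'; rewrite -[RHS](subrr (1 : R)) -[X in _ = _ - X]e'; ring.
by move/eqP; rewrite mulf_eq0 sqrf_eq0 => /orP[]/eqP; lra.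
Qed.

(** The sine is 1-Lipschitz, so its value 1/2 at pi / 6 is at most pi / 6. *)
Lemma pi_ge3 : 3 <= pi :> R.
Proof.
have := ler_sin_dist (pi / 6) 0; rewrite sin0 !subr0 sin_pi6.
have p0 := @pi_gt0 R; rewrite !ger0_norm ?divr_ge0 //; lra.
Qed.

(** The slope 3 is that of the chord from 0 to y = 1/6, where the sine is 1/2. *)
Lemma sin_pi_ge3 y : 0 <= y <= 1 / 6 -> 3 * y <= sin (pi * y).
Proof.
have p0 := @pi_gt0 R => hy.
have := @sin_chord (pi * y) (pi / 6); rewrite sin_pi6 => h.
have {h} : pi * (y * (1 / 2)) <= pi * (1 / 6 * sin (pi * y)).
  have : 0 <= pi * y <= pi / 6 by apply/andP; split; nra.
  by move=> /h /(_ ltac:(lra)); lra.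
rewrite ler_pM2l //; lra.
Qed.

Lemma sin_pi_ge_half y : 1 / 6 <= y <= 1 / 2 -> 1 / 2 <= sin (pi * y).
Proof.
have p0 := @pi_gt0 R => hy.
have p6 : (pi : R) / 6 \in `[- (pi / 2), pi / 2] by rewrite in_itv /=; lra.
have yI : pi * y \in `[- (pi / 2), pi / 2] by rewrite in_itv /=; nra.
by rewrite -sin_pi6 leNgt ltr_sin // -leNgt; nra.
Qed.

Lemma norm_sin_pi y : `|sin (pi * y)| = `|sin (pi * `|y|)|.
Proof. by case: (ger0P y) => // _; rewrite mulrN sinN normrN. Qed.

Lemma norm_sin_pi_ge3 y : `|y| <= 1 / 6 -> 3 * `|y| <= `|sin (pi * y)|.
Proof.
move=> hy; rewrite norm_sin_pi; apply: le_trans (ler_norm _).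
by apply: sin_pi_ge3; rewrite normr_ge0.
Qed.

Lemma norm_sin_pi_ge t y : t <= 1 / 6 -> t <= `|y| <= 1 / 2 ->
  3 * t <= `|sin (pi * y)|.
Proof.
move=> t6 /andP[ty y2]; have [y6|y6] := lerP `|y| (1 / 6).
  by apply: le_trans (norm_sin_pi_ge3 y6); lra.
rewrite norm_sin_pi; apply: le_trans (ler_norm _).
have := @sin_pi_ge_half `|y|; lra.
Qed.

Lemma norm_inv_sin_le t y : 0 < t -> 3 * t <= `|sin (pi * y)| ->
  `|(2 * sin (pi * y))^-1| <= (6 * t)^-1.
Proof.
move=> t0 h; rewrite normfV normrM ger0_norm // lef_pV2 ?posrE; lra.
Qed.

(** Discrete primitives of the sine and cosine. The shift by 1/2 centres the difference between [j]
    and [j.+1] at [j], which produces the factor 2 sin (nu / 2) that the denominator removes. *)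
Definition antisin nu j : R :=
  - cos (nu * (j%:R - 1 / 2)) / (2 * sin (nu / 2)).
Definition anticos nu j : R :=
  sin (nu * (j%:R - 1 / 2)) / (2 * sin (nu / 2)).

(* At [nu = 0] the division by zero makes both functions identically 0. *)
Lemma antisinS nu j : nu = 0 \/ sin (nu / 2) != 0 ->
  antisin nu j.+1 - antisin nu j = sin (nu * j%:R).
Proof.
case=> [->|s0]; first by rewrite /antisin !mul0r sin0 mulr0 invr0 !mulr0 subr0.
have -> : nu * j%:R = nu * (j%:R - 1 / 2) + nu / 2 by field.
rewrite /antisin.
have -> : nu * (j.+1%:R - 1 / 2) = nu * (j%:R - 1 / 2) + nu / 2 + nu / 2.
  by rewrite -natr1; field.
have -> : cos (nu * (j%:R - 1 / 2)) =
  cos (nu * (j%:R - 1 / 2) + nu / 2 - nu / 2) by congr cos; ring.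
by rewrite cosD cosB; field.
Qed.

Lemma anticosS nu j : sin (nu / 2) != 0 ->
  anticos nu j.+1 - anticos nu j = cos (nu * j%:R).
Proof.
move=> s0; have -> : nu * j%:R = nu * (j%:R - 1 / 2) + nu / 2 by field.
rewrite /anticos.
have -> : nu * (j.+1%:R - 1 / 2) = nu * (j%:R - 1 / 2) + nu / 2 + nu / 2.
  by rewrite -natr1; field.
have -> : sin (nu * (j%:R - 1 / 2)) =
  sin (nu * (j%:R - 1 / 2) + nu / 2 - nu / 2) by congr sin; ring.
by rewrite sinD sinB; field.
Qed.

Lemma antisin_le nu j : `|antisin nu j| <= `|(2 * sin (nu / 2))^-1|.
Proof. by rewrite /antisin normrM ler_piMl // normrN cos_max. Qed.

Lemma anticos_le nu j : `|anticos nu j| <= `|(2 * sin (nu / 2))^-1|.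
Proof. by rewrite /anticos normrM ler_piMl // sin_max. Qed.

End Trigonometry.

(** * Perturbed contractions *)

Section PerturbedContraction.
Context {R : realType} {n : nat}.
Variables (L : 'M[R]_n) (th : nat -> 'cV[R]_n) (G : nat -> 'cV[R]_n -> 'cV[R]_n).
Variables (D : nat) (sigma0 sigma r g l dl ell : R).
Hypotheses (r_ge0 : 0 <= r) (r_lt1 : r < 1) (l_ge0 : 0 <= l) (g_ge0 : 0 <= g)
  (dl_ge0 : 0 <= dl) (ell_ge0 : 0 <= ell).
Hypotheses (LB : forall u, enorm (u - L *m u) <= r * enorm u)
  (Ll : forall u, enorm (L *m u) <= l * enorm u)
  (Gg : forall j u, enorm u <= sigma -> enorm (G j u) <= g).
Hypotheses (init : forall j, (j <= D)%N -> enorm (th j) <= sigma0)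
  (init_lt : sigma0 < sigma).
Hypothesis step : forall j, (D <= j)%N ->
  (forall i, (i <= j)%N -> enorm (th i) < sigma) ->
  enorm (th j.+1 + G j.+1 (th j) - (th j + G j (th j) - L *m th j)) <= dl /\
  enorm (G j.+1 (th j.+1) - G j.+1 (th j)) <= ell.

(** The defect of [z] in one step. [LB] contracts all of [z j], whereas in [step] the matrix [L]
    acts on [th j] alone; the missing [L *m G j (th j)] costs [l * g]. Advancing time costs [dl],
    moving the state costs [ell]. In [small] the last [g] pays for returning from [z] to [th]. *)
Let Y := l * g + dl + ell.
Hypothesis small : sigma0 + g + Y / (1 - r) + g < sigma.

Let z j := th j + G j (th j).

(* [th j.+1] is first bounded through [G j.+1 (th j)], whose argument is already
   known to lie in the ball of radius [sigma]; only then does [z j.+1] make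
   sense as a small perturbation of [th j.+1]. *)
Lemma contraction_bound m :
  (forall i, (i <= D + m)%N -> enorm (th i) < sigma) /\
  enorm (z (D + m)) <= r ^+ m * (sigma0 + g) + Y / (1 - r).
Proof.
have Y0 : 0 <= Y by rewrite /Y !addr_ge0 ?mulr_ge0.
have q0 : 0 <= Y / (1 - r) by rewrite divr_ge0 // subr_ge0 ltW.
have s0 : 0 <= sigma0 := le_trans (enorm_ge0 _) (init (leqnn D)).
have lt0 i : (i <= D)%N -> enorm (th i) < sigma.
  by move/init/le_lt_trans; apply.
elim: m => [|m [IH1 IH2]].
  rewrite addn0 expr0 mul1r; split=> //.
  apply: le_trans (ler_enormD _ _) _.
  by have := init (leqnn D); have := Gg D (ltW (lt0 _ (leqnn D))); lra.
rewrite addnS; set j := (D + m)%N in IH1 IH2 *.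
have [dj ej] := step (leq_addr m D) IH1.
rewrite -/j in dj ej.
have gj : enorm (G j (th j)) <= g by apply: Gg; exact/ltW/IH1.
have gj1 : enorm (G j.+1 (th j)) <= g by apply: Gg; exact/ltW/IH1.
have b1 : enorm (th j.+1 + G j.+1 (th j)) <= r * enorm (z j) + l * g + dl.
  have -> : th j.+1 + G j.+1 (th j) = (z j - L *m z j) + L *m G j (th j)
     + (th j.+1 + G j.+1 (th j) - (th j + G j (th j) - L *m th j)).
    rewrite /z mulmxDr.
    apply/colP => i; rewrite !mxE; ring.
  apply: le_trans (ler_enormD _ _) _; apply: lerD dj.
  apply: le_trans (ler_enormD _ _) _; apply: lerD; first exact: LB.
  by apply: le_trans (Ll _) _; exact: ler_wpM2l.
(* [Y / (1 - r)] is the fixed point of the scalar recursion x -> r x + Y. *)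
have b2 : r * enorm (z j) + Y <= r ^+ m.+1 * (sigma0 + g) + Y / (1 - r).
  have := ler_wpM2l r_ge0 IH2; rewrite exprS.
  have : Y / (1 - r) = Y + r * (Y / (1 - r)).
    by field; rewrite subr_eq0 gt_eqF.
  by lra.
have rm : r ^+ m.+1 * (sigma0 + g) <= sigma0 + g.
  by rewrite ler_piMl ?addr_ge0 // exprn_ile1 // ltW.
split=> [i|].
  rewrite leq_eqVlt => /orP[/eqP ->|]; last by rewrite ltnS => /IH1.
  have -> : th j.+1 = th j.+1 + G j.+1 (th j) - G j.+1 (th j) by rewrite addrK.
  apply: le_lt_trans (ler_enormB _ _) _.
  have yE : l * g + dl <= Y by rewrite /Y lerDl.
  by have := small; move: (r ^+ m.+1 * _) b2 rm => A; lra.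
rewrite /z; have -> : th j.+1 + G j.+1 (th j.+1) =
   th j.+1 + G j.+1 (th j) + (G j.+1 (th j.+1) - G j.+1 (th j)).
  by rewrite -addrA (addrC (G j.+1 (th j))) subrK.
apply: le_trans (ler_enormD _ _) _; apply: le_trans b2.
by rewrite /Y; lra.
Qed.

Lemma contraction_lt j : enorm (th j) < sigma.
Proof. by apply: (contraction_bound j).1; exact: leq_addl. Qed.

Lemma contraction_decay j : (D <= j)%N ->
  enorm (th j) <= r ^+ (j - D) * (sigma0 + g) + (Y / (1 - r) + g).
Proof.
move=> Dj; have := (contraction_bound (j - D)).2; rewrite subnKC // /z => h.
have -> : th j = th j + G j (th j) - G j (th j) by rewrite addrK.
apply: le_trans (ler_enormB _ _) _.
by have := Gg j (ltW (contraction_lt j)); lra.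
Qed.

End PerturbedContraction.

(** The ball is open, so the radial projection onto its closure is not an admissible competitor.
    Shrinking the target radius by [r ^+ j] gives a point inside and costs another [r ^+ j], hence
    the [+ 1] in the constant; [r ^- D] covers the times up to [D]. *)
Lemma exp_attracted_ball (R : realType) (n D : nat) (th : nat -> 'cV[R]_n)
    (r K rho : R) : 0 < rho -> 0 < r <= 1 -> 0 <= K ->
  (forall j, (j <= D)%N -> enorm (th j) <= K) ->
  (forall j, (D <= j)%N -> enorm (th j) <= r ^+ (j - D) * K + rho) ->
  exp_attracted th [set x | enorm x < rho]%classic r.
Proof.
move=> rho0 /andP[r0 r1] K0 hi hD; exists (K * r ^- D + 1) => j.
have rj : 0 < r ^+ j by exact: exprn_gt0.
have bj : enorm (th j) <= K * r ^- D * r ^+ j + rho.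
  have [jD|Dj] := leqP j D.
    apply: le_trans (hi _ jD) _.
    have : 1 <= r ^- D * r ^+ j.
      rewrite mulrC ler_pdivlMr ?exprn_gt0 // mul1r.
      by rewrite ler_wiXn2l // ltW.
    by move/(ler_wpM2l K0); rewrite mulr1 mulrA; lra.
  apply: le_trans (hD _ (ltnW Dj)) _; rewrite lerD2r mulrC -mulrA ler_wpM2l //.
  by rewrite -[in leRHS](subnK (ltnW Dj)) exprD mulrC mulfK // expf_neq0 // gt_eqF.
have KD : 0 <= K * r ^- D * r ^+ j by rewrite !mulr_ge0 ?invr_ge0 ?exprn_ge0 // ltW.
pose Z : set 'cV[R]_n := [set x | enorm x < rho]%classic.
have dist w : enorm w < rho -> enorm (th j - w) <= (K * r ^- D + 1) * r ^+ j ->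
   (edist_set (th j) Z <= ((K * r ^- D + 1) * r ^+ j)%:E)%E.
  move=> wr le; apply: le_trans (_ : ((enorm (th j - w))%:E <= _)%E).
    by apply: ereal_inf_lbound; exists w.
  by rewrite lee_fin.
have [lt|ge] := ltP (enorm (th j)) rho.
  by apply: (dist _ lt); rewrite subrr enorm0 mulr_ge0 ?addr_ge0 //; nra.
(* The maximum with 0 covers early times, when [r ^+ j] may exceed [rho]; the competitor is then the
   origin. *)
pose rho' := Num.max (rho - r ^+ j) 0.
have [t0 tr] : 0 <= rho' /\ rho' < rho.
  by rewrite /rho' le_max lexx orbT gt_max rho0 andbT; split => //; lra.
have n0 : 0 < enorm (th j) by exact: lt_le_trans ge.
have l0 : 0 <= rho' / enorm (th j) by rewrite divr_ge0 ?enorm_ge0.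
apply: (dist (rho' / enorm (th j) *: th j)).
  by rewrite enormZ ger0_norm // divfK // gt_eqF.
rewrite -[X in X - _]scale1r -scalerBl enormZ ger0_norm; last first.
  by rewrite subr_ge0 ler_pdivrMr // mul1r; lra.
rewrite mulrBl divfK ?gt_eqF // mul1r.
have : rho - r ^+ j <= rho' by rewrite /rho' le_max lexx.
lra.
Qed.

(** * Sums of the dithers *)

Section Correctors.
Context {R : realType} {n : nat}.
Variables (DM : nat) (a : 'cV[R]_n) (H : 'M[R]_n) (HM eps : R).
Hypotheses (n_gt0 : (0 < n)%N) (a_gt0 : forall i, 0 < a i 0).
Local Notation T := (period n DM eps).
Local Notation om := (omega DM eps).
Hypothesis period_ge : 13 * n%:R <= T.
Hypotheses (HM_ge0 : 0 <= HM) (H_le : forall l m, `|H l m| <= HM).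

Definition corrP (j : nat) : 'cV[R]_n := \col_i (2 / a i 0 * antisin (om i) j).

(* On the diagonal [anticos 0 = 0] accounts for the subtracted identity. *)
Definition corrW (j : nat) : 'M[R]_n := \matrix_(i, l)
  (a l 0 / a i 0 * (anticos (om i - om l) j - anticos (om i + om l) j)).

(** Based on 4 sin x sin y sin z = sin(x+y-z) + sin(x-y+z) - sin(x+y+z) - sin(x-y-z). A vanishing
    combination of frequencies contributes sin 0 = 0, whose primitive [antisin 0] is 0. *)
Definition corrV (j : nat) : 'cV[R]_n := \col_i
  (1 / a i 0 * \sum_l \sum_m H l m * a l 0 * a m 0 / 4 *
    (antisin (om i + om l - om m) j + antisin (om i - om l + om m) j
     - antisin (om i + om l + om m) j - antisin (om i - om l - om m) j)).

Let n_ge1 : 1 <= n%:R :> R. Proof. by rewrite ler1n. Qed.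
Let T_gt0 : 0 < T. Proof. by have := period_ge; have := n_ge1; lra. Qed.

Let freq (m : int) : R := 2 * pi * m%:~R / T.

Let freq_half (m : int) : freq m / 2 = pi * (m%:~R / T).
Proof. by rewrite /freq; field; rewrite gt_eqF. Qed.

Let omE (i : 'I_n) : om i = freq i.+1%:Z.
Proof. by []. Qed.

Let freqD m p : freq m + freq p = freq (m + p).
Proof. by rewrite /freq rmorphD; field; rewrite gt_eqF. Qed.

Let freqB m p : freq m - freq p = freq (m - p).
Proof. by rewrite /freq rmorphB; field; rewrite gt_eqF. Qed.

Let norm_div_T (x : R) : `|x / T| = `|x| / T.
Proof. by rewrite normrM normfV (gtr0_norm T_gt0). Qed.

(** A nonzero integer has modulus at least 1, so a nonzero frequency cannot come closer to 0 than
    one step 2 pi / T; on the other side |m| / T <= 3/13 < 1/2. *)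
Lemma freq0_or_sin (m : int) : `|m%:~R| <= 3 * n%:R :> R ->
  freq m = 0 \/ 3 * T^-1 <= `|sin (freq m / 2)|.
Proof.
move=> hm; have [->|m0] := eqVneq m 0; first by left; rewrite /freq mulr0 mul0r.
right; rewrite freq_half; apply: norm_sin_pi_ge.
  by rewrite -[T^-1]mul1r ler_pdivrMr //; have := period_ge; have := n_ge1; lra.
have m1 : 1 <= `|m%:~R : R|.
  by rewrite -intr_norm -[1]/(1%:~R) ler_int; move: m0; rewrite -normr_gt0.
rewrite norm_div_T -{1}[T^-1]mul1r ler_pM2r ?invr_gt0 // m1 /=.
by rewrite ler_pdivrMr //; have := period_ge; have := n_ge1; lra.
Qed.

Lemma freq_antisin_le (m : int) j : `|m%:~R| <= 3 * n%:R :> R ->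
  `|antisin (freq m) j| <= T / 6.
Proof.
move=> /freq0_or_sin[->|h].
  rewrite /antisin mul0r cos0 mul0r sin0 mulr0 invr0 mulr0 normr0.
  by rewrite divr_ge0 // ltW.
apply: le_trans (antisin_le _ _) _; rewrite freq_half in h *.
apply: le_trans (norm_inv_sin_le _ h) _; first by rewrite invr_gt0.
by rewrite invfM invrK mulrC.
Qed.

Lemma freq_antisinS (m : int) j : `|m%:~R| <= 3 * n%:R :> R ->
  antisin (freq m) j.+1 - antisin (freq m) j = sin (freq m * j%:R).
Proof.
move=> /freq0_or_sin h; apply: antisinS; case: h => [->|h]; [by left|right].
by rewrite -normr_gt0; apply: lt_le_trans h; rewrite mulr_gt0 ?invr_gt0.
Qed.

Let ord_le (i : 'I_n) : 1 <= (i.+1%:R : R) <= n%:R.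
Proof. by rewrite (ler_nat R 1) ler_nat /= ltn_ord. Qed.

(** For at most two indices |m| / T <= 2/13 < 1/6, so the bound linear in |m| is available; it
    produces the weights 1 / |i - l| and 1 / (i + l) of [rho1]. *)
Lemma freq_sin_ge (m : int) : `|m%:~R| <= 2 * n%:R :> R ->
  3 * (`|m%:~R| / T) <= `|sin (freq m / 2)|.
Proof.
move=> hm; rewrite freq_half -norm_div_T; apply: norm_sin_pi_ge3.
by rewrite norm_div_T ler_pdivrMr //; have := period_ge; have := n_ge1; lra.
Qed.

Lemma freq_inv_sin_le (m : int) : 0 < `|m%:~R : R| <= 2 * n%:R ->
  `|(2 * sin (freq m / 2))^-1| <= T / 6 * (1 / `|m%:~R|).
Proof.
move=> /andP[m0 hm]; have := freq_sin_ge hm; rewrite freq_half => h.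
apply: le_trans (norm_inv_sin_le _ h) _; first by rewrite divr_gt0.
by rewrite le_eqVlt; apply/orP; left; apply/eqP; field; rewrite !gt_eqF.
Qed.

Lemma freq_anticosS (m : int) j : 0 < `|m%:~R : R| <= 2 * n%:R ->
  anticos (freq m) j.+1 - anticos (freq m) j = cos (freq m * j%:R).
Proof.
move=> /andP[m0 hm]; apply: anticosS; rewrite -normr_gt0.
by apply: lt_le_trans (freq_sin_ge hm); rewrite mulr_gt0 // divr_gt0.
Qed.

Let om_neq (i l : 'I_n) : i != l ->
  0 < `|(i.+1%:Z - l.+1%:Z)%:~R : R| <= 2 * n%:R.
Proof.
move=> il; rewrite rmorphB /= normr_gt0 subr_eq0 eqr_nat eqSS il /=.
by have := ord_le i; have := ord_le l; rewrite ler_norml; lra.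
Qed.

Let om_add (i l : 'I_n) :
  0 < `|(i.+1%:Z + l.+1%:Z)%:~R : R| <= 2 * n%:R.
Proof.
rewrite rmorphD /= normr_gt0 gt_eqF /=.
  by have := ord_le i; have := ord_le l; rewrite ler_norml; lra.
by have := ord_le i; have := ord_le l; lra.
Qed.

Lemma corrPS j : corrP j.+1 - corrP j = ditherM DM a eps j.
Proof.
apply/colP => i; rewrite !mxE -mulrBr omE freq_antisinS //.
by rewrite ger0_norm //=; have := ord_le i; lra.
Qed.

Lemma corrWS j :
  corrW j.+1 - corrW j = ditherM DM a eps j *m (ditherS DM a eps j)^T - 1%:M.
Proof.
apply/matrixP => i l; rewrite !mxE big_ord1 !mxE -mulrBr.
set x := om i * j%:R; set y := om l * j%:R.
have -> : 2 / a i 0 * sin x * (a l 0 * sin y) =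
   a l 0 / a i 0 * (cos (x - y) - cos (x + y)).
  by rewrite cosB cosD; field; rewrite gt_eqF.
have -> : x + y = (om i + om l) * j%:R by rewrite mulrDl.
have -> : x - y = (om i - om l) * j%:R by rewrite mulrBl.
rewrite (omE i) (omE l) freqD freqB -(freq_anticosS j (om_add i l)).
have [->|il] := eqVneq i l.
  have -> : freq (l.+1%:Z - l.+1%:Z) = 0 by rewrite subrr /freq mulr0 mul0r.
  rewrite divff ?gt_eqF // {1 3}/anticos !mul0r sin0 cos0 !mul0r mulr1n.
  by rewrite !mul1r !sub0r; ring.
by rewrite -(freq_anticosS j (om_neq il)) mulr0n subr0; ring.
Qed.

Let om3 (i l m : 'I_n) (s t : R) : `|s| <= 1 -> `|t| <= 1 ->
  `|i.+1%:R + s * l.+1%:R + t * m.+1%:R| <= 3 * n%:R :> R.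
Proof.
rewrite !ler_norml => hs ht.
have := ord_le i; have := ord_le l; have := ord_le m.
move: i.+1%:R l.+1%:R m.+1%:R => x y z hx hy hz; nra.
Qed.

Let om3E (i l m : 'I_n) :
  [/\ `|(i.+1%:Z + l.+1%:Z - m.+1%:Z)%:~R| <= 3 * n%:R :> R,
      `|(i.+1%:Z - l.+1%:Z + m.+1%:Z)%:~R| <= 3 * n%:R :> R,
      `|(i.+1%:Z + l.+1%:Z + m.+1%:Z)%:~R| <= 3 * n%:R :> R &
      `|(i.+1%:Z - l.+1%:Z - m.+1%:Z)%:~R| <= 3 * n%:R :> R].
Proof.
have n1 : `|- 1 : R| <= 1 by rewrite normrN1.
have p1 : `|1 : R| <= 1 by rewrite normr1.
have := om3 i l m p1 n1; have := om3 i l m n1 p1.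
have := om3 i l m p1 p1; have := om3 i l m n1 n1.
by rewrite !(rmorphD, rmorphB) /= !mulN1r !mul1r; split.
Qed.

Let om3freq (i l m : 'I_n) :
  [/\ freq (i.+1%:Z + l.+1%:Z - m.+1%:Z) = om i + om l - om m,
      freq (i.+1%:Z - l.+1%:Z + m.+1%:Z) = om i - om l + om m,
      freq (i.+1%:Z + l.+1%:Z + m.+1%:Z) = om i + om l + om m &
      freq (i.+1%:Z - l.+1%:Z - m.+1%:Z) = om i - om l - om m].
Proof. by rewrite !omE; split; rewrite ?(freqD, freqB). Qed.

Lemma corrVS j : corrV j.+1 - corrV j =
  (1 / 2 * wnorm2 H (ditherS DM a eps j)) *: ditherM DM a eps j.
Proof.
apply/colP => i; rewrite !mxE -mulrBr -sumrB wnorm2E bformE.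
rewrite !mulr_sumr mulr_suml; apply: eq_bigr => l _.
rewrite -sumrB !mulr_sumr mulr_suml; apply: eq_bigr => m _; rewrite !mxE.
have [h1 h2 h3 h4] := om3E i l m.
have := freq_antisinS j h4; have := freq_antisinS j h3.
have := freq_antisinS j h2; have := freq_antisinS j h1.
have [-> -> -> ->] := om3freq i l m => e1 e2 e3 e4.
transitivity (1 / a i 0 * (H l m * a l 0 * a m 0 / 4 *
   (sin ((om i + om l - om m) * j%:R) + sin ((om i - om l + om m) * j%:R)
    - sin ((om i + om l + om m) * j%:R) - sin ((om i - om l - om m) * j%:R)))).
  by rewrite -e1 -e2 -e3 -e4; ring.
rewrite !(mulrDl, mulNr).
set x := om i * j%:R; set y := om l * j%:R; set z := om m * j%:R.
by rewrite !(sinD, cosD, sinN, cosN); field; rewrite gt_eqF.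
Qed.

Lemma enorm_corrP_le j :
  enorm (corrP j) <= T / 3 * \sum_(i < n) 1 / (i.+1%:R * a i 0).
Proof.
apply: le_trans (enorm_le_sum _) _; rewrite mulr_sumr ler_sum // => i _.
rewrite mxE normrM ger0_norm ?divr_ge0 ?(ltW (a_gt0 _)) //.
have hi := ord_le i.
have h : 0 < `|(i.+1%:Z)%:~R : R| <= 2 * n%:R.
  by rewrite /= ger0_norm //; lra.
have := le_trans (antisin_le (om i) j) (freq_inv_sin_le h).
rewrite [`|_%:~R|]ger0_norm // => b.
have -> : T / 3 * (1 / (i.+1%:R * a i 0)) = 2 / a i 0 * (T / 6 * (1 / i.+1%:R)).
  by field; rewrite !gt_eqF.
by rewrite ler_wpM2l // divr_ge0 // ltW.
Qed.

Lemma sum_corrW_le j : \sum_i \sum_l `|corrW j i l| <= T / 6 *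
  (\sum_(i < n) 1 / i.+1%:R + \sum_(i < n) \sum_(l < n | i != l)
     a l 0 / a i 0 * (1 / `|i.+1%:R - l.+1%:R| + 1 / (i.+1%:R + l.+1%:R))).
Proof.
rewrite -big_split /= mulr_sumr ler_sum // => i _.
rewrite mulrDr mulr_sumr (bigD1 i) //=.
have hadd (l : 'I_n) : `|anticos (om i + om l) j| <= T / 6 * (1 / (i.+1%:R + l.+1%:R)).
  apply: le_trans (anticos_le _ _) _; rewrite (omE i) (omE l) freqD.
  by have := freq_inv_sin_le (om_add i l); rewrite rmorphD /= [in leRHS]ger0_norm.
apply: lerD.
  (* On the diagonal only the sum frequency survives and gives 1 / (2 i), which is below the 1 / i
     of the bound. *)
  rewrite mxE divff ?gt_eqF // mul1r subrr.
  have -> : anticos 0 j = 0 :> R by rewrite /anticos mul0r sin0 mul0r.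
  rewrite mul1r sub0r normrN.
  apply: le_trans (hadd i) _; have := ord_le i => hi.
  rewrite ler_pM2l ?divr_gt0 // !mul1r lef_pV2 ?posrE; lra.
rewrite (eq_bigl (fun l => i != l)); last by move=> l; rewrite eq_sym.
apply: ler_sum => l il; rewrite mxE normrM ger0_norm ?divr_ge0 ?(ltW (a_gt0 _)) //.
rewrite mulrCA ler_wpM2l ?divr_ge0 ?(ltW (a_gt0 _)) //.
apply: le_trans (ler_normB _ _) _; rewrite mulrDr; apply: lerD (hadd l).
apply: le_trans (anticos_le _ _) _; rewrite (omE i) (omE l) freqB.
by have := freq_inv_sin_le (om_neq il); rewrite rmorphB.
Qed.

(** Cauchy-Schwarz against the all-ones vector. The estimate of [corrV] yields the left side, while
    [rho3] contains the sum of squares; the extra factor n is later absorbed by [coef_c]. *)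
Lemma sqr_sum_le : (\sum_i a i 0) ^+ 2 <= n%:R * \sum_i a i 0 ^+ 2.
Proof.
have := @bform_CS R n 1%:M (const_mx 1) a (@trmx1 _ _) (@wnorm2_1_ge0 _ _).
have -> : bform 1%:M (const_mx 1) a = \sum_i a i 0.
  by rewrite /bform mulmx1 mxE; apply: eq_bigr => i _; rewrite !mxE mul1r.
have -> : bform 1%:M (const_mx 1 : 'cV[R]_n) (const_mx 1) = n%:R :> R.
  rewrite /bform mulmx1 mxE (eq_bigr (fun=> 1)) => [|i _]; last first.
    by rewrite !mxE mul1r.
  by rewrite sumr_const card_ord.
have -> // : bform 1%:M a a = \sum_i a i 0 ^+ 2.
by rewrite /bform mulmx1 mxE; apply: eq_bigr => i _; rewrite !mxE.
Qed.

Lemma corrV_le j i :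
  `|corrV j i 0| <= T * n%:R * HM * (\sum_s a s 0 ^+ 2) / 6 / a i 0.
Proof.
rewrite mxE normrM ger0_norm ?divr_ge0 ?(ltW (a_gt0 _)) // mul1r mulrC ler_pM2r ?invr_gt0 //.
have -> : T * n%:R * HM * (\sum_s a s 0 ^+ 2) / 6 =
  HM * T / 6 * (n%:R * \sum_s a s 0 ^+ 2) by field.
apply: (@le_trans _ _ (HM * T / 6 * (\sum_s a s 0) ^+ 2)); last first.
  by rewrite ler_wpM2l ?sqr_sum_le // !mulr_ge0 // ltW.
rewrite expr2 mulr_suml mulr_sumr; apply: le_trans (ler_norm_sum _ _ _) _.
apply: ler_sum => l _; rewrite !mulr_sumr; apply: le_trans (ler_norm_sum _ _ _) _.
apply: ler_sum => m _.
have [h1 h2 h3 h4] := om3E i l m.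
have := freq_antisin_le j h4; have := freq_antisin_le j h3.
have := freq_antisin_le j h2; have := freq_antisin_le j h1.
have [-> -> -> ->] := om3freq i l m.
move: (antisin _ _) (antisin _ _) (antisin _ _) (antisin _ _) => x y z w.
move=> b1 b2 b3 b4.
have -> : HM * T / 6 * (a l 0 * a m 0) = HM * a l 0 * a m 0 / 4 * (T * 4 / 6).
  by field.
rewrite normrM; apply: ler_pM => //.
  rewrite !normrM (gtr0_norm (a_gt0 l)) (gtr0_norm (a_gt0 m)).
  by rewrite (@ger0_norm _ 4^-1) // !ler_pM2r ?invr_gt0.
by move: b1 b2 b3 b4; rewrite !ler_norml; lra.
Qed.

End Correctors.

(** * Consequences of condition (c) *)

Section Constants.
Context {R : realType} {n : nat}.
Variables (DM : nat) (k : R) (a : 'cV[R]_n) (Hm HM sigma Q0 DQ sigma0 eps : R).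
Hypotheses (n_gt0 : (0 < n)%N) (DM_gt0 : (0 < DM)%N) (a_gt0 : forall i, 0 < a i 0).
Hypotheses (k_gt0 : 0 < k) (Hm_gt0 : 0 < Hm) (HmM : Hm <= HM).
Hypotheses (sigma0_ge0 : 0 <= sigma0) (sigma_gt0 : 0 < sigma) (Q_ge0 : 0 <= Q0 + DQ).
Hypothesis eps_gt0 : 0 < eps.

Let HM_gt0 : 0 < HM. Proof. exact: lt_le_trans Hm_gt0 HmM. Qed.
Let nR : 1 <= n%:R :> R. Proof. by rewrite ler1n. Qed.
Let DR : 1 <= DM%:R :> R. Proof. by rewrite ler1n. Qed.
Let se_gt0 : 0 < Num.sqrt eps. Proof. by rewrite sqrtr_gt0. Qed.
Let D_ge0 : 0 <= DM%:R :> R. Proof. exact: ler0n. Qed.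

Lemma normA_ge0 : 0 <= normA a. Proof. exact: sqrtr_ge0. Qed.
Lemma normB_ge0 : 0 <= normB a. Proof. exact: sqrtr_ge0. Qed.

(** A single component already contributes [a i 0] to one norm and its inverse to the other. *)
Lemma normAB_ge1 : 1 <= normA a * normB a.
Proof.
pose i0 := Ordinal n_gt0.
have hA : a i0 0 <= normA a.
  apply: le_trans (ler_norm _) _; exact: ler_norm_enorm.
have hB : (a i0 0)^-1 <= normB a.
  rewrite -(gtr0_norm (_ : 0 < (a i0 0)^-1)) ?invr_gt0 //.
  have := ler_norm_enorm (\col_i (a i 0)^-1) i0; rewrite mxE /enorm /normB.
  by under eq_bigr => i _ do rewrite mxE exprVn.
rewrite -(@divff _ (a i0 0)) ?gt_eqF //.
by apply: ler_pM; rewrite ?invr_ge0 ?(ltW (a_gt0 _)).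
Qed.

(** 0.19245 is 1 / (3 sqrt 3) rounded down, the value given by the chord of the sine on [0, pi/3];
    the chord on [0, pi/6] gives 1/6. Likewise 0.3849 is 2 / (3 sqrt 3) rounded down, against
    1/3. *)
Lemma d0_19245_ge6 : 1 / 6 <= d0_19245 :> R.
Proof. by rewrite /d0_19245; lra. Qed.

Lemma d0_3849_ge3 : 1 / 3 <= d0_3849 :> R.
Proof. by rewrite /d0_3849; lra. Qed.

Let d1 : 0 <= d0_19245 :> R. Proof. by apply: le_trans d0_19245_ge6; lra. Qed.
Let d2 : 0 <= d0_3849 :> R. Proof. by apply: le_trans d0_3849_ge3; lra. Qed.

Lemma rho1_sum_ge1 : 1 <= \sum_(i < n) 1 / i.+1%:R +
   \sum_(i < n) \sum_(l < n | i != l)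
     a l 0 / a i 0 * (1 / `|i.+1%:R - l.+1%:R| + 1 / (i.+1%:R + l.+1%:R)) :> R.
Proof.
rewrite -[leLHS]addr0; apply: lerD.
  rewrite (bigD1 (Ordinal n_gt0)) //= invr1 mulr1 lerDl.
  by apply: sumr_ge0 => i _; rewrite divr_ge0.
apply: sumr_ge0 => i _; apply: sumr_ge0 => l _.
by rewrite !mulr_ge0 ?addr_ge0 ?divr_ge0 ?addr_ge0 ?invr_ge0 ?(ltW (a_gt0 _)).
Qed.

Lemma rho_sum_ge0 : 0 <= \sum_(i < n) 1 / (i.+1%:R * a i 0).
Proof.
by apply: sumr_ge0 => i _; rewrite divr_ge0 ?mulr_ge0 ?(ltW (a_gt0 _)).
Qed.

Lemma rho1_ge : n%:R * DM%:R * k * HM / 6 <= rho1 DM k a HM.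
Proof.
have x0 : 0 <= n%:R * DM%:R * k * HM.
  by rewrite !mulr_ge0 // ltW.
have -> : rho1 DM k a HM = d0_19245 * (n%:R * DM%:R * k * HM) *
    (\sum_(i < n) 1 / i.+1%:R + \sum_(i < n) \sum_(l < n | i != l)
     a l 0 / a i 0 * (1 / `|i.+1%:R - l.+1%:R| + 1 / (i.+1%:R + l.+1%:R))).
  by rewrite /rho1 !mulrA.
apply: le_trans (ler_peMr _ rho1_sum_ge1); last by rewrite mulr_ge0.
by rewrite mulrC ler_wpM2r //; have := d0_19245_ge6; lra.
Qed.

Lemma rho1_ge0 : 0 <= rho1 DM k a HM.
Proof.
by apply: le_trans rho1_ge; rewrite divr_ge0 ?mulr_ge0 ?(ltW k_gt0) ?(ltW HM_gt0).
Qed.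

Lemma rho2_ge0 : 0 <= rho2 DM k a.
Proof. by rewrite !mulr_ge0 ?rho_sum_ge0 ?(ltW k_gt0). Qed.

Lemma rho4_ge0 : 0 <= rho4 DM k a.
Proof. by rewrite !mulr_ge0 ?rho_sum_ge0 ?(ltW k_gt0). Qed.

Lemma rho3_ge0 : 0 <= rho3 DM k a HM eps.
Proof.
rewrite !mulr_ge0 ?sqrtr_ge0 ?(ltW k_gt0) ?(ltW HM_gt0) //.
by apply: sumr_ge0 => i _; rewrite sqr_ge0.
Qed.

(** The product of the leading terms in the first fraction is 2 (n DM)^2 / 12; all other
    contributions are nonnegative. *)
Lemma coef_c_ge (i : 'I_n) : (n%:R * DM%:R) ^+ 2 / 6 <= coef_c DM eps i.
Proof.
rewrite /coef_c; set q := d3_3072 * pi * _.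
have q0 : 0 < q by rewrite !mulr_gt0 // ?pi_gt0 // /d3_3072; lra.
set x := n%:R * DM%:R; have x0 : 0 <= x by rewrite mulr_ge0.
have h : 0 <= (Num.sqrt eps * (Num.sqrt eps + x)
    + DM%:R ^+ 2 * n%:R ^+ 2 * (1 + 1 / q)) / q.
  have q1 : 0 <= 1 + 1 / q by rewrite addr_ge0 // divr_ge0 // ltW.
  rewrite divr_ge0 ?(ltW q0) // addr_ge0 ?mulr_ge0 ?sqr_ge0 ?sqrtr_ge0 //.
  by rewrite addr_ge0 ?sqrtr_ge0.
by move: h se_gt0; move: (_ / q) => y; nra.
Qed.

Lemma DeltaG_ge_rho1 : rho1 DM k a HM * sigma <= DeltaG DM k a HM sigma Q0 DQ eps.
Proof.
rewrite /DeltaG -!addrA lerDl addr_ge0 //; first exact: (mulr_ge0 rho2_ge0 Q_ge0).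
rewrite addr_ge0 ?rho3_ge0 //.
exact: (mulr_ge0 (mulr_ge0 rho4_ge0 (sqr_ge0 _)) (ltW HM_gt0)).
Qed.

Lemma DeltaG_ge0 : 0 <= DeltaG DM k a HM sigma Q0 DQ eps.
Proof. by apply: le_trans DeltaG_ge_rho1; exact: (mulr_ge0 rho1_ge0 (ltW sigma_gt0)). Qed.

Lemma sigma_y_ge0 : 0 <= sigma_y a HM sigma.
Proof. by rewrite mulr_ge0 ?sqr_ge0 // divr_ge0 // ltW. Qed.

Lemma Delta_ge0 : 0 <= Delta k a HM sigma Q0 DQ.
Proof.
rewrite /Delta -addrA mulr_ge0 ?normB_ge0 // !mulr_ge0 ?(ltW k_gt0) //.
by rewrite addr_ge0 ?sigma_y_ge0.
Qed.

Section SmallSqrt.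
Hypothesis se_lt1 : Num.sqrt eps < 1.

(** Comes from the summand 2 pi A / ((1 - sqrt eps) DM): its DM cancels the one in front, and
    [normAB_ge1] removes both norms. *)
Lemma DeltaOut_ge :
  4 * pi * k * HM * sigma / (1 - Num.sqrt eps) <= DeltaOut DM k a HM sigma Q0 DQ eps.
Proof.
have s1 : 0 < 1 - Num.sqrt eps by rewrite subr_gt0.
have A0 := normA_ge0; have B0 := normB_ge0; have AB := normAB_ge1.
have D0 : 0 < DM%:R :> R by apply: lt_le_trans DR.
have h1 : 0 <= 2 * k * DM%:R * HM * normB a * (sigma + normA a).
  by rewrite !mulr_ge0 ?addr_ge0 ?(ltW k_gt0) ?(ltW HM_gt0) ?(ltW sigma_gt0).
rewrite /DeltaOut; apply: (@le_trans _ _ (2 * k * DM%:R * HM * normB a * (sigma + normA a)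
    * (2 * pi * normA a / ((1 - Num.sqrt eps) * DM%:R)))).
  have -> : 2 * k * DM%:R * HM * normB a * (sigma + normA a)
    * (2 * pi * normA a / ((1 - Num.sqrt eps) * DM%:R)) =
    4 * pi * k * HM / (1 - Num.sqrt eps) * (normA a * normB a * (sigma + normA a)).
    by field; rewrite !gt_eqF.
  have -> : 4 * pi * k * HM * sigma / (1 - Num.sqrt eps) =
     4 * pi * k * HM / (1 - Num.sqrt eps) * sigma by ring.
  apply: ler_wpM2l.
    by rewrite divr_ge0 ?mulr_ge0 ?pi_ge0 ?(ltW k_gt0) ?(ltW HM_gt0) ?(ltW s1).
  have := sigma_gt0; nra.
apply: ler_wpM2l => //; apply: ler_wpDl.
  exact: (mulr_ge0 (ltW se_gt0) Delta_ge0).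
rewrite ler_peMr ?lerDr ?divr_ge0 ?mulr_ge0 ?pi_ge0 ?(ltW s1) ?(ltW se_gt0) //.
Qed.

Lemma DeltaOut_ge0 : 0 <= DeltaOut DM k a HM sigma Q0 DQ eps.
Proof.
apply: le_trans DeltaOut_ge; rewrite divr_ge0 ?subr_ge0 ?(ltW se_lt1) //.
by rewrite !mulr_ge0 ?pi_ge0 ?(ltW k_gt0) ?(ltW HM_gt0) ?(ltW sigma_gt0).
Qed.

Lemma DeltaY_ge_Out :
  DeltaOut DM k a HM sigma Q0 DQ eps <= DeltaY DM k a HM sigma Q0 DQ eps.
Proof.
have E0 : 0 <= Delta k a HM sigma Q0 DQ
    + Num.sqrt eps * DeltaOut DM k a HM sigma Q0 DQ eps.
  exact: (addr_ge0 Delta_ge0 (mulr_ge0 (ltW se_gt0) DeltaOut_ge0)).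
rewrite /DeltaY; set E := (_ + _) in E0 *.
have t1 := mulr_ge0 (mulr_ge0 (ltW k_gt0) (ltW HM_gt0)) DeltaG_ge0.
have t2 := mulr_ge0 rho1_ge0 E0.
have t3 : 0 <= 2 * rho4 DM k a * sigma * HM * E.
  exact: (mulr_ge0 (mulr_ge0 (mulr_ge0 (mulr_ge0 (ler0n _ 2) rho4_ge0) (ltW sigma_gt0))
    (ltW HM_gt0)) E0).
have t4 : 0 <= eps * rho4 DM k a * HM * E ^+ 2.
  exact: (mulr_ge0 (mulr_ge0 (mulr_ge0 (ltW eps_gt0) rho4_ge0) (ltW HM_gt0))
    (sqr_ge0 E)).
by rewrite ler_wpDr // ler_wpDl // (addr_ge0 (addr_ge0 t1 t2) t3).
Qed.

Lemma DeltaY_ge0 : 0 <= DeltaY DM k a HM sigma Q0 DQ eps.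
Proof. exact: le_trans DeltaOut_ge0 DeltaY_ge_Out. Qed.

End SmallSqrt.

Hypotheses (hA : condA n DM eps) (hB : condB k Hm eps)
  (hC : condC DM k a Hm HM sigma Q0 DQ sigma0 eps).

(** Condition (a) forces the floor to be at least 1, hence sqrt eps <= 1; equality is excluded by
    the first conjunct of [condC]. *)
Lemma condC_sqrt_lt1 : Num.sqrt eps < 1.
Proof.
case: hC => s1 _ _; rewrite lt_neqAle -subr_eq0 -oppr_eq0 opprB s1 /=.
have f1 : (1 <= floor_inv_sqrt eps)%R.
  rewrite -gtz0_ge1 ltNge; apply/negP => f0.
  have := hA; rewrite /condA => h.
  have h1 : n%:Z * DM%:Z * floor_inv_sqrt eps <= 0.
    by rewrite mulr_ge0_le0.
  have p : 0 < 2 * n%:Z + 1 by rewrite ltr_wpDl.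
  by have := lt_le_trans p (le_trans h h1); rewrite ltxx.
move: f1; rewrite /floor_inv_sqrt floor_ge_int mulr1z ler_pdivlMr //.
by rewrite mul1r.
Qed.

(** The power with exponent [- DM] is at least 1. For the second bound, 1 - |1 - x| <= x with x =
    eps k Hm, so the last term of (c) gives an inequality with a factor eps on both sides. *)
Lemma condC_split :
  [/\ Num.sqrt eps * DeltaG DM k a HM sigma Q0 DQ eps < sigma,
      Num.sqrt eps * DeltaY DM k a HM sigma Q0 DQ eps < sigma * (k * Hm) &
      sigma0 + 2 * (Num.sqrt eps * DeltaG DM k a HM sigma Q0 DQ eps)
      + Num.sqrt eps ^+ 3 * DeltaY DM k a HM sigma Q0 DQ eps
        / (1 - `|1 - eps * k * Hm|) < sigma].
Proof.
have G0 := DeltaG_ge0; have Y0 := DeltaY_ge0 condC_sqrt_lt1.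
case: hC => _ x1 hlt; have hx : eps * k * Hm < 2 := hB.
have x0 : 0 < eps * k * Hm by rewrite !mulr_gt0.
set x := eps * k * Hm in x1 hlt hx x0 *.
have r1 : `|1 - x| < 1 by rewrite ltr_norml; lra.
have rx : 1 - `|1 - x| <= x by have := ler_norm (1 - x); lra.
have r0 : 0 < `|1 - x| by rewrite normr_gt0.
have ri : 1 <= `|1 - x| ^- DM by rewrite invf_ge1 ?exprn_gt0 // exprn_ile1 // ltW.
move: (`|1 - x|) r1 rx r0 ri hlt => r r1 rx r0 ri.
move: (DeltaG _ _ _ _ _ _ _ _) (DeltaY _ _ _ _ _ _ _ _) G0 Y0 => DG DY G0 Y0.
have se2 : Num.sqrt eps ^+ 2 = eps by rewrite sqr_sqrtr // ltW.
have := se_gt0; move: (Num.sqrt eps) se2 => se se2 se0 hlt.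
have sG : 0 <= se * DG by rewrite mulr_ge0 // ltW.
have sY : 0 <= se ^+ 3 * DY / (1 - r).
  by rewrite divr_ge0 ?mulr_ge0 ?exprn_ge0 ?subr_ge0 // ltW.
have b1 : sigma0 + se * DG <= (sigma0 + se * DG) * r ^- DM.
  by rewrite ler_peMr // addr_ge0.
split; [have := sigma0_ge0; lra | | lra].
have : se ^+ 3 * DY / (1 - r) < sigma by have := sigma0_ge0; lra.
rewrite ltr_pdivrMr ?subr_gt0 // => h.
have {}h : se ^+ 2 * (se * DY) < se ^+ 2 * (sigma * (k * Hm)).
  rewrite mulrA -exprSr; apply: lt_le_trans h _.
  rewrite mulrCA ler_wpM2l ?(ltW sigma_gt0) //.
  by apply: le_trans rx _; rewrite /x se2 mulrA.
by move: h; rewrite ltr_pM2l // exprn_gt0.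
Qed.

(** Chaining [DeltaOut <= DeltaY] with the second part of [condC_split] and Hm <= HM yields 4 pi
    sqrt eps < 1 - sqrt eps; since pi >= 3, the constant is 4 * 3 + 1. *)
Lemma condC_sqrt_lt : 13 * Num.sqrt eps < 1.
Proof.
have s1 := condC_sqrt_lt1; have [_ h _] := condC_split.
have h2 := le_trans (DeltaOut_ge s1) (DeltaY_ge_Out s1).
have h3 := lt_le_trans (le_lt_trans (ler_wpM2l (ltW se_gt0) h2) h)
  (ler_wpM2l (ltW sigma_gt0) (ler_wpM2l (ltW k_gt0) HmM)).
have h4 : sigma * (k * HM) * (Num.sqrt eps * (4 * pi)) <
    sigma * (k * HM) * (1 - Num.sqrt eps).
  rewrite -ltr_pdivrMr ?subr_gt0 //; apply: le_lt_trans h3.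
  by rewrite le_eqVlt; apply/orP; left; apply/eqP; ring.
move: h4; rewrite ltr_pM2l ?mulr_gt0 //.
by have := @pi_ge3 R; have := se_gt0; nra.
Qed.

(** From sqrt eps * rho1 * sigma < sigma and [rho1_ge], sqrt eps * k * HM < 6; the remaining factor
    sqrt eps is below 1/13. *)
Lemma condC_HM : eps * k * HM < 1.
Proof.
have s13 := condC_sqrt_lt; have [h _ _] := condC_split.
have h1 := ler_wpM2l (ltW se_gt0) (le_trans (ler_wpM2r (ltW sigma_gt0) rho1_ge)
  DeltaG_ge_rho1).
have := le_lt_trans h1 h.
rewrite mulrA -[X in _ < X]mul1r ltr_pM2r // => h2.
have se2 : Num.sqrt eps ^+ 2 = eps by rewrite sqr_sqrtr // ltW.
have h3 : k * HM <= n%:R * DM%:R * k * HM.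
  rewrite -!mulrA mulrA ler_peMl ?mulr_ge0 ?(ltW k_gt0) ?(ltW HM_gt0) //.
  by rewrite -[leLHS]mulr1 ler_pM.
rewrite -mulrA -se2 expr2; have := se_gt0.
have x0 : 0 < k * HM by rewrite mulr_gt0.
move: (Num.sqrt eps) (k * HM) h2 h3 s13 x0 => s X; move: (n%:R * _ * _ * _) => Z; nra.
Qed.

End Constants.

(** * Loewner bounds and the dither period *)

Section Loewner.
Context {R : realType} {n : nat}.
Variables (H : 'M[R]_n) (Hm HM : R).
Hypotheses (H_lower : loewner_le Hm%:M H) (H_upper : loewner_le H HM%:M).

Lemma loewner_bounds u : Hm * enorm u ^+ 2 <= wnorm2 H u <= HM * enorm u ^+ 2.
Proof.
have := H_lower u; have := H_upper u; rewrite !wnorm2B !wnorm2_scalar.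
by move=> h1 h2; apply/andP; split; lra.
Qed.

Lemma loewner_scalar_le : (0 < n)%N -> Hm <= HM.
Proof.
move=> n0; have := loewner_bounds (delta_mx (Ordinal n0) 0).
have -> : enorm (delta_mx (Ordinal n0) 0 : 'cV[R]_n) = 1 by rewrite enorm_delta.
by rewrite expr1n !mulr1 => /andP[]; exact: le_trans.
Qed.

(** [c * HM <= 1] makes I - c H semidefinite, so that the upper bound 1 - c Hm on its quadratic form
    also bounds its norm. *)
Lemma loewner_contraction (c : R) : H^T = H -> (0 < n)%N -> 0 <= c ->
  c * HM <= 1 -> forall u, enorm (u - (c *: H) *m u) <= (1 - c * Hm) * enorm u.
Proof.
move=> sH n0 c0 cH u.
have -> : u - (c *: H) *m u = (1%:M - c *: H) *m u by rewrite mulmxBl mul1mx.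
have wE w : wnorm2 (1%:M - c *: H) w = enorm w ^+ 2 - c * wnorm2 H w.
  by rewrite wnorm2B wnorm2Z wnorm2_scalar mul1r.
have bE w : c * Hm * enorm w ^+ 2 <= c * wnorm2 H w <= c * HM * enorm w ^+ 2.
  by have /andP[h1 h2] := loewner_bounds w; rewrite -!mulrA !ler_wpM2l.
apply: enorm_mulmx_sym => [|w||w].
- by rewrite linearB /= trmx1 linearZ /= sH.
- rewrite wE; have /andP[_] := bE w.
  by have := ler_wpM2r (sqr_ge0 (enorm w)) cH; lra.
- rewrite subr_ge0; apply: le_trans cH.
  by rewrite ler_wpM2l // loewner_scalar_le.
- by rewrite wE; have := bE w; lra.
Qed.

End Loewner.

Section Period.
Context {R : realType}.
Variables (n DM : nat) (eps : R).
Hypotheses (n_gt0 : (0 < n)%N) (DM_gt0 : (0 < DM)%N) (eps_gt0 : 0 < eps)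
  (s13 : 13 * Num.sqrt eps < 1).

(** The floor is at least 13, so the first entry of the maximum is the larger one; the floor
    brackets 1 / sqrt eps within 1. The upper bound on T controls the correctors, the lower one the
    phase shift caused by the delay. *)
Lemma period_bounds : [/\ 13 * n%:R <= period n DM eps,
  Num.sqrt eps * period n DM eps <= n%:R * DM%:R &
  n%:R * DM%:R * (1 - Num.sqrt eps) <= Num.sqrt eps * period n DM eps].
Proof.
have nR : 1 <= n%:R :> R by rewrite ler1n.
have DR : 1 <= DM%:R :> R by rewrite ler1n.
rewrite /period; set N : R := (floor_inv_sqrt eps)%:~R.
have := s13; have : 0 < Num.sqrt eps by rewrite sqrtr_gt0.
have N13 : 13 <= N.
  rewrite (ler_int R 13%:Z) floor_ge_int ler_pdivlMr ?sqrtr_gt0 //.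
  exact: ltW.
have /andP[N1 N2] : N * Num.sqrt eps <= 1 < (N + 1) * Num.sqrt eps.
  rewrite -ler_pdivlMr ?sqrtr_gt0 // -ltr_pdivrMr ?sqrtr_gt0 //.
  have := floor_itv (1 / Num.sqrt eps).
  by rewrite rmorphD.
move: (Num.sqrt eps) (N) N13 N1 N2 => s M M13 M1 M2 s0 s1.
have DM13 : 13 <= DM%:R * M by nra.
have x13 : 13 * n%:R <= n%:R * DM%:R * M by nra.
have p0 : 0 <= n%:R * DM%:R :> R by nra.
have -> : Num.max (n%:R * DM%:R * M) (2 * n%:R + 1) = n%:R * DM%:R * M.
  by apply/max_idPl; lra.
split=> //.
- have := ler_wpM2l p0 M1; lra.
- have h : 1 - s <= M * s by lra.
  have := ler_wpM2l p0 h; lra.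
Qed.

End Period.

(** * The averaging transformation *)

Section Averaging.
Context {R : realType} {n : nat}.
Variables (DM : nat) (H : 'M[R]_n) (Hm HM sigma0 Q0 DQ Qs k sigma eps_s eps : R).
Variables (a : 'cV[R]_n) (D : nat -> nat) (th : nat -> 'cV[R]_n).
Hypotheses (n_gt0 : (0 < n)%N) (DM_gt0 : (0 < DM)%N) (a_gt0 : forall i, 0 < a i 0).
Hypotheses (Hm_gt0 : 0 < Hm) (H_sym : H^T = H).
Hypotheses (H_lower : loewner_le Hm%:M H) (H_upper : loewner_le H HM%:M).
Hypotheses (sigma0_gt0 : 0 < sigma0) (Qs_le : `|Qs| <= Q0 + DQ) (k_gt0 : 0 < k).
Hypotheses (sigma_gt : sigma0 < sigma) (eps_s_gt0 : 0 < eps_s).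
Hypotheses (hA : condA n DM eps_s) (hB : condB k Hm eps_s)
  (hC : condC DM k a Hm HM sigma Q0 DQ sigma0 eps_s).
Hypotheses (eps_gt0 : 0 < eps) (eps_le : eps <= eps_s).
Hypotheses (D_le : forall j, (D j <= DM)%N)
  (th_sol : es_solution DM k a H Qs eps D th)
  (th_init : forall j, (j <= DM)%N -> enorm (th j) <= sigma0).

Local Notation se := (Num.sqrt eps).
Local Notation ss := (Num.sqrt eps_s).
Local Notation T := (period n DM eps).
Local Notation P := (corrP DM a eps).
Local Notation W := (corrW DM a eps).
Local Notation V := (corrV DM a H eps).
Local Notation S := (ditherS DM a eps).
Local Notation M := (ditherM DM a eps).
Local Notation DG := (DeltaG DM k a HM sigma Q0 DQ eps_s).
Local Notation DY := (DeltaY DM k a HM sigma Q0 DQ eps_s).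
Local Notation Dl := (Delta k a HM sigma Q0 DQ).
Local Notation DO := (DeltaOut DM k a HM sigma Q0 DQ eps_s).
Local Notation r1 := (rho1 DM k a HM).
Local Notation r2 := (rho2 DM k a).
Local Notation r3 := (rho3 DM k a HM eps_s).
Local Notation r4 := (rho4 DM k a).
Local Notation A := (normA a).
Local Notation B := (normB a).

Let HmM : Hm <= HM. Proof. exact: loewner_scalar_le H_lower H_upper n_gt0. Qed.
Let HM_gt0 : 0 < HM. Proof. exact: lt_le_trans Hm_gt0 HmM. Qed.
Let HM_ge0 : 0 <= HM. Proof. exact: ltW. Qed.
Let sigma_gt0 : 0 < sigma. Proof. exact: lt_trans sigma0_gt0 sigma_gt. Qed.
Let sigma_ge0 : 0 <= sigma. Proof. exact: ltW. Qed.
Let Q_ge0 : 0 <= Q0 + DQ. Proof. exact: le_trans (normr_ge0 _) Qs_le. Qed.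
Let se_gt0 : 0 < se. Proof. by rewrite sqrtr_gt0. Qed.
Let se_ge0 : 0 <= se. Proof. exact: sqrtr_ge0. Qed.
Let se_le : se <= ss. Proof. by rewrite ler_wsqrtr. Qed.
Let se2 : se ^+ 2 = eps. Proof. by rewrite sqr_sqrtr // ltW. Qed.
Let k_ge0 : 0 <= k. Proof. exact: ltW. Qed.
Let eps_ge0 : 0 <= eps. Proof. exact: ltW. Qed.
Let ss_lt : 13 * ss < 1.
Proof.
exact: (condC_sqrt_lt n_gt0 DM_gt0 a_gt0 k_gt0 Hm_gt0 HmM (ltW sigma0_gt0)
  sigma_gt0 Q_ge0 eps_s_gt0 hA hB hC).
Qed.
Let ss_lt1 : ss < 1.
Proof. by have := ss_lt; have := sqrtr_ge0 eps_s; lra. Qed.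
Let epsHM : eps * k * HM < 1.
Proof.
have := condC_HM n_gt0 DM_gt0 a_gt0 k_gt0 Hm_gt0 HmM (ltW sigma0_gt0) sigma_gt0
  Q_ge0 eps_s_gt0 hA hB hC.
by apply: le_lt_trans; rewrite -!mulrA ler_wpM2r // mulr_ge0.
Qed.
Let se_lt : 13 * se < 1.
Proof. by have := ss_lt; have := se_le; lra. Qed.

Let T13 : 13 * n%:R <= T.
Proof. by have [] := period_bounds n_gt0 DM_gt0 eps_gt0 se_lt. Qed.
Let seT : se * T <= n%:R * DM%:R.
Proof. by have [] := period_bounds n_gt0 DM_gt0 eps_gt0 se_lt. Qed.
Let seT_ge : n%:R * DM%:R * (1 - se) <= se * T.
Proof. by have [] := period_bounds n_gt0 DM_gt0 eps_gt0 se_lt. Qed.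
Let n_ge1 : 1 <= n%:R :> R. Proof. by rewrite ler1n. Qed.
Let DM_ge1 : 1 <= DM%:R :> R. Proof. by rewrite ler1n. Qed.
Let T_gt0 : 0 < T. Proof. by have := T13; have := n_ge1; lra. Qed.

Let H_ge0 u : 0 <= wnorm2 H u.
Proof.
have /andP[h _] := loewner_bounds H_lower H_upper u.
by apply: le_trans h; rewrite mulr_ge0 ?sqr_ge0 // ltW.
Qed.
Let H_leM u : wnorm2 H u <= HM * enorm u ^+ 2.
Proof. by have /andP[] := loewner_bounds H_lower H_upper u. Qed.
Let H_form u v : `|bform H u v| <= HM * enorm u * enorm v.
Proof. exact: ler_bform. Qed.
Let H_mulmx u : enorm (H *m u) <= HM * enorm u.
Proof. exact: enorm_mulmx_sym. Qed.
Let H_entry i l : `|H i l| <= HM.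
Proof. exact: ler_mx_entry. Qed.

(** One half-power of eps is spent on the period; this turns each bound of order T into a bound of
    order sqrt eps with the factor n DM of the [rho] constants. *)
Lemma eps_T_le (x : R) : 0 <= x -> eps * T * x <= se * (n%:R * DM%:R * x).
Proof.
move=> x0; have -> : eps * T * x = se * (se * T * x).
  by rewrite !mulrA -expr2 se2.
by rewrite ler_wpM2l // ler_wpM2r.
Qed.

Lemma corrP_rho2 j : eps * k * enorm (P j) <= se * r2.
Proof.
have s0 := rho_sum_ge0 a_gt0.
have h := ler_wpM2l (mulr_ge0 eps_ge0 k_ge0) (enorm_corrP_le n_gt0 a_gt0 T13 j).
apply: le_trans h _; rewrite /rho2; move: (\sum_i _) s0 => Z Z0.
have h1 := eps_T_le (mulr_ge0 k_ge0 Z0).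
have h2 : 0 <= se * (n%:R * DM%:R * (k * Z)) by rewrite !mulr_ge0.
have := ler_wpM2r h2 (d0_3849_ge3 (R := R)); lra.
Qed.

(** Used where [P] carries half of the squared H-norm of the state: the 2 cancels that half. Where
    it carries [Qs], the same vector is measured by [rho2]. *)
Lemma corrP_rho4 j : eps * k * enorm (P j) <= 2 * (se * r4).
Proof.
have s0 := rho_sum_ge0 a_gt0.
have h := ler_wpM2l (mulr_ge0 eps_ge0 k_ge0) (enorm_corrP_le n_gt0 a_gt0 T13 j).
apply: le_trans h _; rewrite /rho4; move: (\sum_i _) s0 => Z Z0.
have h1 := eps_T_le (mulr_ge0 k_ge0 Z0).
have h2 : 0 <= se * (n%:R * DM%:R * (k * Z)) by rewrite !mulr_ge0.
have := ler_wpM2r h2 (d0_19245_ge6 (R := R)); lra.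
Qed.

Lemma corrW_rho1 j u : eps * k * enorm (W j *m (H *m u)) <= se * r1 * enorm u.
Proof.
have Z1 := rho1_sum_ge1 n_gt0 a_gt0.
have h0 : enorm (W j *m (H *m u)) <=
  (\sum_i \sum_l `|W j i l|) * (HM * enorm u).
  apply: le_trans (enorm_mulmx _ _) _; rewrite ler_wpM2l //.
  by apply: sumr_ge0 => i _; apply: sumr_ge0.
have h1 := le_trans h0 (ler_wpM2r (mulr_ge0 HM_ge0 (enorm_ge0 u))
   (sum_corrW_le n_gt0 a_gt0 T13 j)).
apply: le_trans (ler_wpM2l (mulr_ge0 eps_ge0 k_ge0) h1) _.
rewrite /rho1; move: (_ + _) Z1 => Z Z1.
have u0 := enorm_ge0 u; move: (enorm u) u0 => x x0.
have Z0 : 0 <= Z by lra.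
have q0 : 0 <= k * HM * Z * x by rewrite !mulr_ge0.
have h2 := eps_T_le q0.
have h3 : 0 <= se * (n%:R * DM%:R * (k * HM * Z * x)) by rewrite !mulr_ge0.
have := ler_wpM2r h3 (d0_19245_ge6 (R := R)); lra.
Qed.

Lemma corrV_rho3 j : eps * k * enorm (V j) <= se * r3.
Proof.
set A2 := \sum_s a s 0 ^+ 2.
have A2_ge0 : 0 <= A2 by apply: sumr_ge0 => i _; exact: sqr_ge0.
set nD : R := n%:R * DM%:R.
have nD0 : 0 < nD by rewrite mulr_gt0 // ltr0n.
have THA0 : 0 <= T * HM * A2 := mulr_ge0 (mulr_ge0 (ltW T_gt0) HM_ge0) A2_ge0.
have t0 : 0 <= T * HM * A2 / nD := divr_ge0 THA0 (ltW nD0).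
(* Multiplying and dividing by n DM makes room for [coef_c], which is at least (n DM)^2 / 6; what is
   left over is n <= n DM. *)
have h i : `|V j i 0| <= T * HM * A2 / nD * (coef_c DM eps_s i / a i 0).
  apply: le_trans (corrV_le n_gt0 a_gt0 T13 HM_ge0 H_entry j i) _.
  rewrite mulrA ler_pM2r ?invr_gt0 //.
  have c := coef_c_ge DM eps_s_gt0 i.
  apply: le_trans (ler_wpM2l t0 c); rewrite -/nD -/A2.
  have -> : T * HM * A2 / nD * (nD ^+ 2 / 6) = T * HM * A2 / 6 * nD.
    by field; rewrite gt_eqF.
  have -> : T * n%:R * HM * A2 / 6 = T * HM * A2 / 6 * n%:R by ring.
  apply: ler_wpM2l; first exact: divr_ge0.
  by rewrite /nD ler_peMr // (le_trans ler01).
have := enorm_le_scale t0 h.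
under eq_bigr => i _ do rewrite expr_div_n.
rewrite /rho3 -/A2; have := sqrtr_ge0 (\sum_i coef_c DM eps_s i ^+ 2 / a i 0 ^+ 2).
move: (Num.sqrt (\sum_i _)) => Z Z0 hV.
apply: le_trans (ler_wpM2l (mulr_ge0 eps_ge0 k_ge0) hV) _.
have q0 : 0 <= k * HM * A2 * Z / nD by rewrite divr_ge0 ?(ltW nD0) // !mulr_ge0.
have -> : eps * k * (T * HM * A2 / nD * Z) = eps * T * (k * HM * A2 * Z / nD) by ring.
have -> : se * (k * HM * A2 * Z) = se * (nD * (k * HM * A2 * Z / nD)).
  by field; rewrite gt_eqF.
exact: eps_T_le.
Qed.

(** Time and state are separate arguments, so that the passage to [j.+1] can be split into
    [corrG_step] (time) and [corrG_lip] (state). *)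
Definition corrG (j : nat) (u : 'cV[R]_n) : 'cV[R]_n :=
  (eps * k) *: ((Qs + 1 / 2 * wnorm2 H u) *: P j + W j *m (H *m u) + V j).

Let ek0 : 0 <= eps * k. Proof. exact: mulr_ge0. Qed.

Lemma enorm_corrG j u : enorm u <= sigma -> enorm (corrG j u) <= se * DG.
Proof.
move=> us; rewrite enormZ (ger0_norm ek0).
have h0 := le_trans (ler_enormD ((Qs + 1 / 2 * wnorm2 H u) *: P j + W j *m (H *m u)) (V j))
  (lerD (ler_enormD ((Qs + 1 / 2 * wnorm2 H u) *: P j) (W j *m (H *m u))) (lexx _)).
apply: le_trans (ler_wpM2l ek0 h0) _; rewrite enormZ.
have u2 : enorm u ^+ 2 <= sigma ^+ 2 by rewrite lerXn2r ?nnegrE ?enorm_ge0.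
have hq : `|Qs + 1 / 2 * wnorm2 H u| <= (Q0 + DQ) + HM * sigma ^+ 2 / 2.
  apply: le_trans (ler_normD _ _) _; apply: lerD => //.
  have h2 := H_ge0 u; rewrite ger0_norm; last by lra.
  by have := le_trans (H_leM u) (ler_wpM2l HM_ge0 u2); lra.
have b2 := ler_wpM2l Q_ge0 (corrP_rho2 j).
have b4 := ler_wpM2l (mulr_ge0 HM_ge0 (sqr_ge0 sigma)) (corrP_rho4 j).
have b1 := le_trans (corrW_rho1 j u) (ler_wpM2l (mulr_ge0 se_ge0
  (rho1_ge0 DM n_gt0 a_gt0 k_gt0 Hm_gt0 HmM)) us).
have b3 := corrV_rho3 j.
have bq := ler_wpM2r (mulr_ge0 ek0 (enorm_ge0 (P j))) hq.
rewrite /DeltaG; move: (rho1 _ _ _ _) (rho2 _ _ _) (rho3 _ _ _ _ _) (rho4 _ _ _)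
  (enorm (P j)) (enorm (W j *m _)) (enorm (V j)) (`|_|) b1 b2 b3 b4 bq
  => x1 x2 x3 x4 p w v q.
lra.
Qed.

Lemma enorm_ditherM j : enorm (M j) <= 2 * B.
Proof.
have h i : `|M j i 0| <= 2 * (a i 0)^-1.
  rewrite mxE !normrM normfV (gtr0_norm (a_gt0 i)) (@ger0_norm _ 2) //.
  by rewrite ler_piMr ?sin_max // divr_ge0 // ltW.
have := enorm_le_scale (ler0n _ 2) h.
by under eq_bigr => i _ do rewrite exprVn.
Qed.

Lemma enorm_ditherS j : enorm (S j) <= A.
Proof.
rewrite -[A]mul1r; apply: enorm_le_scale => // i.
by rewrite mul1r mxE normrM (gtr0_norm (a_gt0 i)) ler_piMr ?sin_max // ltW.
Qed.

(** The phase turned during the longest delay. The numerator keeps the actual sqrt eps, which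
    supplies the extra half-power; the denominator is taken at [eps_s] as in [DeltaOut]. *)
Lemma omega_DM_le (i : 'I_n) :
  omega DM eps i * DM%:R <= 2 * pi * (se / (1 - ss)).
Proof.
have s1 : 0 < 1 - se by have := se_lt; have := se_ge0; lra.
have s2 : 0 < 1 - ss by rewrite subr_gt0.
apply: (@le_trans _ _ (2 * pi * (n%:R * DM%:R / T))).
  have -> : omega DM eps i * DM%:R = 2 * pi * (i.+1%:R * DM%:R / T).
    by rewrite /omega; ring.
  rewrite ler_wpM2l ?mulr_ge0 ?pi_ge0 // ler_pM2r ?invr_gt0 //.
  by rewrite ler_wpM2r // ler_nat ltn_ord.
rewrite ler_wpM2l ?mulr_ge0 ?pi_ge0 // ler_pdivrMr //.
apply: (@le_trans _ _ (se / (1 - se) * T)).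
  by rewrite mulrAC ler_pdivlMr.
rewrite ler_wpM2r ?(ltW T_gt0) // ler_wpM2l // lef_pV2 ?posrE //.
by have := se_le; lra.
Qed.

Lemma ditherS_dist i j : (i <= j)%N -> (j - i <= DM)%N ->
  enorm (S i - S j) <= 2 * pi * (se / (1 - ss)) * A.
Proof.
move=> ij jiD; apply: enorm_le_scale => [|l].
  apply: mulr_ge0; first by rewrite mulr_ge0 ?pi_ge0.
  by rewrite divr_ge0 // subr_ge0 ltW.
rewrite !mxE -mulrBr normrM (gtr0_norm (a_gt0 l)) mulrC.
rewrite ler_wpM2r ?(ltW (a_gt0 l)) //.
apply: le_trans (ler_sin_dist _ _) _; rewrite -mulrBr.
have o0 : 0 <= omega DM eps l.
  by rewrite /omega divr_ge0 ?(ltW T_gt0) // !mulr_ge0 ?pi_ge0.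
rewrite normrM (ger0_norm o0) distrC -natrB // ger0_norm //.
apply: le_trans (omega_DM_le l); rewrite ler_wpM2l //.
by rewrite ler_nat.
Qed.

Lemma enorm_th_ditherS i j : enorm (th i) < sigma ->
  enorm (th i + S j) <= sigma + A.
Proof.
move=> h; apply: le_trans (ler_enormD _ _) _.
by apply: lerD; [exact: ltW|exact: enorm_ditherS].
Qed.

Let A_ge0 : 0 <= A. Proof. exact: sqrtr_ge0. Qed.
Let B_ge0 : 0 <= B. Proof. exact: sqrtr_ge0. Qed.
Let Dl_ge0 : 0 <= Dl.
Proof. exact: Delta_ge0 k_gt0 Hm_gt0 HmM Q_ge0. Qed.

(** [sigma_y] + Q0 + DQ bounds the output and 2 B the demodulating dither. On the initial window the
    state is frozen, so increments reaching back before [DM] cause no trouble. *)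
Lemma th_step i : (forall l, (l <= i)%N -> enorm (th l) < sigma) ->
  enorm (th i.+1 - th i) <= eps * Dl.
Proof.
case: th_sol => th0 thS bd.
have [iD|Di] := ltnP i DM.
  by rewrite (th0 i.+1) // (th0 i) 1?ltnW // subrr enorm0 mulr_ge0.
rewrite thS // [X in enorm X]addrAC subrr add0r enormN enormZ normrM (ger0_norm ek0).
set v := th (i - D i)%N + _.
have hv : enorm v <= sigma + A by apply: enorm_th_ditherS; apply: bd; exact: leq_subr.
have hy : `|Qs + 1 / 2 * wnorm2 H v| <= sigma_y a HM sigma + Q0 + DQ.
  apply: le_trans (ler_normD _ _) _.
  have h2 := H_ge0 v; rewrite (@ger0_norm _ (1 / 2 * _)); last by lra.
  have v2 : enorm v ^+ 2 <= (sigma + A) ^+ 2.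
    by rewrite lerXn2r ?nnegrE ?enorm_ge0 // addr_ge0.
  have := le_trans (H_leM v) (ler_wpM2l HM_ge0 v2).
  by rewrite /sigma_y; have := Qs_le; lra.
have := ler_pM (normr_ge0 _) (enorm_ge0 _) hy (enorm_ditherM i).
move=> /(ler_wpM2l ek0); rewrite mulrA => /le_trans; apply.
by rewrite le_eqVlt; apply/orP; left; apply/eqP; rewrite /Delta; ring.
Qed.

Lemma th_dist j d : (forall l, (l <= j)%N -> enorm (th l) < sigma) ->
  enorm (th (j - d)%N - th j) <= d%:R * (eps * Dl).
Proof.
move=> bd; elim: d => [|d IH].
  by rewrite subn0 subrr enorm0 mul0r.
have h : enorm (th (j - d.+1)%N - th (j - d)%N) <= eps * Dl.
  have [dj|jd] := ltnP d j.
    rewrite -[X in th X - _]/(j - d.+1)%N -enormN opprB.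
    rewrite -(subnSK dj); apply: th_step => l lj; apply: bd.
    by apply: leq_trans lj _; exact: leq_subr.
  (* Here [j <= d], so both truncated differences are 0. *)
  have -> : (j - d.+1 = j - d)%N.
    by rewrite subnS; move/eqP: jd => ->.
  by rewrite subrr enorm0 mulr_ge0.
rewrite -(subrK (th (j - d)%N) (th (j - d.+1)%N)) -addrA.
apply: le_trans (ler_enormD _ _) _; apply: le_trans (lerD h IH) _.
by rewrite -natr1 mulrDl mul1r addrC.
Qed.

Lemma wnorm2_sub u v : wnorm2 H u - wnorm2 H v = bform H (u - v) (u + v).
Proof.
have -> : u - v = u + (-1) *: v by rewrite scaleN1r.
by rewrite !wnorm2E !(bformDl, bformDr) !bformZl (bformC v u H_sym); ring.
Qed.

(** At a frozen state the increments of [P], [W] and [V] reproduce the undelayed update, with -H th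
    added by the subtracted identity. What remains is half the difference of |v|_H^2 and its delayed
    value; it factors as a form in v - v' and v + v', and v - v' is O(sqrt eps). *)
Lemma corrG_step j : (DM <= j)%N ->
  (forall l, (l <= j)%N -> enorm (th l) < sigma) ->
  enorm (th j.+1 + corrG j.+1 (th j)
    - (th j + corrG j (th j) - ((eps * k) *: H) *m th j)) <= eps * se * DO.
Proof.
move=> Dj bd; case: th_sol => _ thS.
set v := th j + S j; set v' := th (j - D j)%N + S (j - D j)%N.
have -> : th j.+1 + corrG j.+1 (th j)
    - (th j + corrG j (th j) - ((eps * k) *: H) *m th j)
    = (eps * k * (1 / 2) * (wnorm2 H v - wnorm2 H v')) *: M j.
  have eP : P j.+1 = P j + M j.
    by rewrite -(corrPS a n_gt0 T13) addrC subrK.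
  have eV : V j.+1 = V j + (1 / 2 * wnorm2 H (S j)) *: M j.
    by rewrite -(corrVS H n_gt0 a_gt0 T13) addrC subrK.
  have eW : W j.+1 = W j + (M j *m (S j)^T - 1%:M).
    by rewrite -(corrWS n_gt0 a_gt0 T13) addrC subrK.
  have eB : M j *m (S j)^T *m (H *m th j) = bform H (S j) (th j) *: M j.
    rewrite -!mulmxA [X in _ *m X = _]mx11_scalar mul_mx_scalar /bform.
    by rewrite !mulmxA.
  rewrite thS // -/v' /corrG eP eV eW mulmxDl mulmxBl mul1mx eB -scalemxAl.
  have -> : wnorm2 H v = wnorm2 H (th j) + 2 * bform H (S j) (th j) + wnorm2 H (S j).
    by rewrite /v wnorm2D // (bformC (S j) (th j) H_sym).
  move: (H *m th j) (W j *m _) (P j) (V j) (M j) => X Y p w m.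
  apply/colP => i; by rewrite !mxE; field.
rewrite enormZ -[_ * (1 / 2) * _]mulrA normrM (ger0_norm ek0) normrM wnorm2_sub.
have hd : enorm (v - v') <= DM%:R * (eps * Dl) + 2 * pi * (se / (1 - ss)) * A.
  rewrite -enormN opprB /v /v' opprD addrACA.
  apply: le_trans (ler_enormD _ _) _; apply: lerD.
    apply: le_trans (th_dist _ bd) _.
    apply: ler_wpM2r; first exact: mulr_ge0.
    by rewrite ler_nat.
  apply: ditherS_dist; first exact: leq_subr.
  by rewrite subKn // (leq_trans (D_le j)).
have hs : enorm (v + v') <= 2 * (sigma + A).
  apply: le_trans (ler_enormD _ _) _; rewrite mulrDl mul1r.
  apply: lerD; apply: enorm_th_ditherS; apply: bd => //; exact: leq_subr.
have hb : `|bform H (v - v') (v + v')| <=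
   HM * (DM%:R * (eps * Dl) + 2 * pi * (se / (1 - ss)) * A) * (2 * (sigma + A)).
  apply: le_trans (H_form _ _) _; apply: ler_pM; rewrite ?mulr_ge0 ?enorm_ge0 //.
  exact: ler_wpM2l.
have hbM := ler_pM (normr_ge0 _) (enorm_ge0 _) hb (enorm_ditherM j).
have {}hbM := ler_wpM2l ek0 hbM.
have s2 : 0 < 1 - ss by rewrite subr_gt0.
have D0 : 0 < DM%:R :> R by rewrite ltr0n.
pose K := 2 * k * DM%:R * HM * B * (sigma + A).
(* [DeltaOut] is split as K (ss Dl + X (y + 1)); the estimate obtained is K (se Dl + X), and y >=
   0. *)
have K0 : 0 <= K by rewrite /K !mulr_ge0 // addr_ge0.
pose X := 2 * pi * A / ((1 - ss) * DM%:R).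
have X0 : 0 <= X.
  by apply: divr_ge0; rewrite !mulr_ge0 ?pi_ge0 // ltW.
pose y := pi * ss / ((1 - ss) * DM%:R).
have y0 : 0 <= y.
  by apply: divr_ge0; rewrite !mulr_ge0 ?pi_ge0 ?sqrtr_ge0 // ltW.
have -> : DO = K * (ss * Dl + X * (y + 1)) by [].
apply: (@le_trans _ _ (eps * se * (K * (se * Dl + X)))); last first.
  rewrite ler_wpM2l ?mulr_ge0 // ler_wpM2l //; apply: lerD.
    exact: ler_wpM2r.
  by rewrite ler_peMr // lerDr.
have -> : eps * se * (K * (se * Dl + X)) = (eps * k
    * (HM * (DM%:R * (eps * Dl) + 2 * pi * (se / (1 - ss)) * A) * (2 * (sigma + A))
    * (2 * B))) * (1 / 2).
  rewrite /K /X; have := se2; move: (Num.sqrt eps) => s <-.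
  by field; rewrite !gt_eqF.
rewrite (@ger0_norm _ (1 / 2)) //.
have h2 : 0 <= 1 / 2 :> R by rewrite divr_ge0.
have := ler_wpM2r h2 hbM; apply: le_trans.
by rewrite le_eqVlt; apply/orP; left; apply/eqP; ring.
Qed.

(** In the application [v] is the next state, not yet known to lie in the ball. Hence v + u is
    bounded through 2 u + (v - u), which gives the linear term with 2 sigma and the quadratic one in
    [Dl + ss * DO]. *)
Lemma corrG_lip j u v : enorm u <= sigma -> enorm (v - u) <= eps * Dl ->
  enorm (corrG j v - corrG j u) <= eps * se * (r1 * (Dl + ss * DO)
    + 2 * r4 * sigma * HM * (Dl + ss * DO)
    + eps_s * r4 * HM * (Dl + ss * DO) ^+ 2).
Proof.
move=> us vu.
have DO0 : 0 <= DO.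
  exact: (DeltaOut_ge0 n_gt0 DM_gt0 a_gt0 k_gt0 Hm_gt0 HmM).
have E0 : 0 <= Dl + ss * DO by rewrite addr_ge0 // mulr_ge0 ?sqrtr_ge0.
have r10 : 0 <= r1 := rho1_ge0 DM n_gt0 a_gt0 k_gt0 Hm_gt0 HmM.
have r40 : 0 <= r4 := rho4_ge0 DM a_gt0 k_gt0.
(* The increment is enlarged to the quantity E in terms of which [DeltaY] is written. *)
have {}vu : enorm (v - u) <= eps * (Dl + ss * DO).
  apply: le_trans vu _; rewrite ler_wpM2l // lerDl.
  by rewrite mulr_ge0 ?sqrtr_ge0.
move: (Dl + _) E0 vu => E E0 vu.
have -> : corrG j v - corrG j u =
  (eps * k) *: ((1 / 2 * (wnorm2 H v - wnorm2 H u)) *: P j + W j *m (H *m (v - u))).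
  rewrite /corrG !mulmxBr; apply/colP => i.
  move: (W j *m _) (W j *m _) => x y; rewrite !mxE; ring.
rewrite enormZ (ger0_norm ek0).
have := ler_enormD ((1 / 2 * (wnorm2 H v - wnorm2 H u)) *: P j) (W j *m (H *m (v - u))).
move=> /(ler_wpM2l ek0) /le_trans; apply; rewrite mulrDr enormZ.
have b1 := le_trans (corrW_rho1 j (v - u)) (ler_wpM2l (mulr_ge0 se_ge0 r10) vu).
have b4 := corrP_rho4 j.
have d0 := enorm_ge0 (v - u).
have hsum : enorm (v + u) <= 2 * sigma + eps * E.
  have -> : v + u = (v - u) + (2 : R) *: u.
    by rewrite scaler_nat mulr2n addrA subrK.
  apply: le_trans (ler_enormD _ _) _; rewrite enormZ ger0_norm // addrC.
  by apply: lerD => //; rewrite ler_wpM2l.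
have hq : `|1 / 2 * (wnorm2 H v - wnorm2 H u)| <=
    1 / 2 * (HM * (eps * E) * (2 * sigma + eps * E)).
  rewrite normrM (@ger0_norm _ (1 / 2)) // ler_wpM2l // wnorm2_sub.
  apply: le_trans (H_form _ _) _; apply: ler_pM; rewrite ?mulr_ge0 ?enorm_ge0 //.
  exact: ler_wpM2l.
have q0 : 0 <= 1 / 2 * (HM * (eps * E) * (2 * sigma + eps * E)).
  by rewrite !mulr_ge0 // addr_ge0 // mulr_ge0.
have c1 := ler_wpM2r (mulr_ge0 ek0 (enorm_ge0 (P j))) hq.
have c2 := ler_wpM2l q0 b4.
have c3 : eps * se * (eps * r4 * HM * E ^+ 2) <= eps * se * (eps_s * r4 * HM * E ^+ 2).
  have := ler_wpM2r (mulr_ge0 (mulr_ge0 r40 HM_ge0) (sqr_ge0 E)) eps_le.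
  by rewrite !mulrA => h; rewrite -!(mulrA (eps * se)) ler_wpM2l // mulr_ge0.
move: c1 c2 c3 b1 q0 {hq}; move: (`|_|) (enorm (P j)) (enorm (W j *m _)) => q p w.
move: (rho4 _ _ _) (rho1 _ _ _ _) => x4 x1 c1 c2 c3 b1 q0.
lra.
Qed.

Lemma es_bounds : [/\ forall j, enorm (th j) < sigma,
   0 < `|1 - eps * k * Hm| < 1 &
   forall j, (DM <= j)%N -> enorm (th j) <=
     `|1 - eps * k * Hm| ^+ (j - DM) * (sigma0 + se * DG)
     + se * (DG + eps * DY / (1 - `|1 - eps * k * Hm|))].
Proof.
have DO0 : 0 <= DO.
  exact: (DeltaOut_ge0 n_gt0 DM_gt0 a_gt0 k_gt0 Hm_gt0 HmM).
have DG0 : 0 <= DG := DeltaG_ge0 DM eps_s n_gt0 a_gt0 k_gt0 Hm_gt0 HmM sigma_gt0 Q_ge0.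
have DY0 : 0 <= DY.
  exact: (DeltaY_ge0 n_gt0 DM_gt0 a_gt0 k_gt0 Hm_gt0 HmM).
have r10 : 0 <= r1 := rho1_ge0 DM n_gt0 a_gt0 k_gt0 Hm_gt0 HmM.
have r40 : 0 <= r4 := rho4_ge0 DM a_gt0 k_gt0.
have E0 : 0 <= Dl + ss * DO by rewrite addr_ge0 // mulr_ge0 ?sqrtr_ge0.
pose L := eps * se * (r1 * (Dl + ss * DO) + 2 * r4 * sigma * HM * (Dl + ss * DO)
    + eps_s * r4 * HM * (Dl + ss * DO) ^+ 2).
have L0 : 0 <= L.
  have h1 := mulr_ge0 r10 E0.
  have h2 := mulr_ge0 (mulr_ge0 (mulr_ge0 (mulr_ge0 (ler0n _ 2) r40) sigma_ge0) HM_ge0) E0.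
  have h3 := mulr_ge0 (mulr_ge0 (mulr_ge0 (ltW eps_s_gt0) r40) HM_ge0) (sqr_ge0 (Dl + ss * DO)).
  exact: (mulr_ge0 (mulr_ge0 eps_ge0 se_ge0) (addr_ge0 (addr_ge0 h1 h2) h3)).
have x0 : 0 < eps * k * Hm by rewrite !mulr_gt0.
have x1 : eps * k * Hm < 1.
  by apply: le_lt_trans epsHM; rewrite ler_wpM2l.
have rE : `|1 - eps * k * Hm| = 1 - eps * k * Hm by rewrite ger0_norm // subr_ge0 ltW.
(* [DeltaY] is exactly the sum of the three one-step defects [l * g], [dl] and [ell], divided by eps
   sqrt eps. *)
have YE : eps * k * HM * (se * DG) + eps * se * DO + L = eps * se * DY.
  by rewrite /L /DeltaY; ring.
have [_ _ hC3] := condC_split n_gt0 DM_gt0 a_gt0 k_gt0 Hm_gt0 HmM (ltW sigma0_gt0)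
  sigma_gt0 Q_ge0 eps_s_gt0 hA hB hC.
have xs0 : 0 < eps_s * k * Hm by rewrite !mulr_gt0.
have xs1 : eps_s * k * Hm < 1.
  have := condC_HM n_gt0 DM_gt0 a_gt0 k_gt0 Hm_gt0 HmM (ltW sigma0_gt0) sigma_gt0
    Q_ge0 eps_s_gt0 hA hB hC.
  by apply: le_lt_trans; rewrite ler_wpM2l // mulr_ge0 // ltW.
have rsE : `|1 - eps_s * k * Hm| = 1 - eps_s * k * Hm.
  by rewrite ger0_norm // subr_ge0 ltW.
have opB (x : R) : 1 - (1 - x) = x by rewrite opprB addrC subrK.
(* After division by 1 - r = eps k Hm the defect is sqrt eps * DY / (k Hm). This increases with eps,
   so the bound at [eps_s] supplied by (c) suffices. *)
have small : sigma0 + se * DG + (eps * k * HM * (se * DG) + eps * se * DO + L)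
    / (1 - (1 - eps * k * Hm)) + se * DG < sigma.
  rewrite YE; apply: le_lt_trans hC3; rewrite rsE !opB.
  have ss2 : ss ^+ 2 = eps_s by rewrite sqr_sqrtr // ltW.
  have -> : ss ^+ 3 * DY / (eps_s * k * Hm) = ss * (DY / (k * Hm)).
    have s0 : 0 < ss by rewrite sqrtr_gt0.
    move: (DeltaY _ _ _ _ _ _ _ _) => Y.
    move: ss2; move: (Num.sqrt eps_s) s0 => s s0 <-.
    by field; rewrite !gt_eqF.
  have -> : eps * se * DY / (eps * k * Hm) = se * (DY / (k * Hm)).
    by field; rewrite !gt_eqF.
  have h1 := ler_wpM2r DG0 se_le.
  have q0 : 0 <= DY / (k * Hm) by rewrite divr_ge0 // mulr_ge0 // ltW.
  have h2 := ler_wpM2r q0 se_le.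
  by lra.
have Ll u : enorm ((eps * k) *: H *m u) <= eps * k * HM * enorm u.
  rewrite -scalemxAl enormZ (ger0_norm ek0) -mulrA.
  exact: ler_wpM2l.
have LB u : enorm (u - (eps * k) *: H *m u) <= (1 - eps * k * Hm) * enorm u.
  exact: (loewner_contraction H_lower H_upper H_sym n_gt0 ek0 (ltW epsHM)).
have step j : (DM <= j)%N -> (forall i, (i <= j)%N -> enorm (th i) < sigma) ->
  enorm (th j.+1 + corrG j.+1 (th j) - (th j + corrG j (th j) - (eps * k) *: H *m th j))
    <= eps * se * DO /\ enorm (corrG j.+1 (th j.+1) - corrG j.+1 (th j)) <= L.
  move=> Dj bd; split; first exact: corrG_step.
  by apply: corrG_lip; [exact/ltW/bd|exact: th_step].
have r0 : 0 <= 1 - eps * k * Hm by rewrite subr_ge0 ltW.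
have rlt : 1 - eps * k * Hm < 1 by rewrite gtrDl oppr_lt0.
have l0 : 0 <= eps * k * HM by rewrite mulr_ge0.
have g0 : 0 <= se * DG := mulr_ge0 se_ge0 DG0.
have d0 : 0 <= eps * se * DO := mulr_ge0 (mulr_ge0 eps_ge0 se_ge0) DO0.
split.
- exact: (contraction_lt r0 rlt l0 g0 d0 L0 LB Ll enorm_corrG th_init sigma_gt step small).
- by rewrite rE subr_gt0 x1.
- move=> j Dj.
  have := contraction_decay r0 rlt l0 g0 d0 L0 LB Ll enorm_corrG th_init sigma_gt
    step small Dj.
  rewrite YE rE => /le_trans; apply.
  by rewrite le_eqVlt; apply/orP; left; apply/eqP; ring.
Qed.

Lemma es_attracted :
  exp_attracted th (Theta DM k a Hm HM sigma Q0 DQ eps_s eps) `|1 - eps * k * Hm|.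
Proof.
have [_ /andP[r0 rlt] dec] := es_bounds.
have r10 := rho1_ge DM n_gt0 a_gt0 k_gt0 Hm_gt0 HmM.
have G1 : r1 * sigma <= DG by exact: (DeltaG_ge_rho1 _ _ _ a_gt0 k_gt0 Hm_gt0 HmM).
(* Strict positivity is needed: [Theta] is an open ball and would be empty for radius 0. *)
have DG0 : 0 < DG.
  apply: lt_le_trans G1; rewrite mulr_gt0 //; apply: lt_le_trans r10.
  by rewrite divr_gt0 // !mulr_gt0 // ltr0n.
have DY0 : 0 <= DY.
  exact: (DeltaY_ge0 n_gt0 DM_gt0 a_gt0 k_gt0 Hm_gt0 HmM).
apply: (exp_attracted_ball (D := DM) (K := sigma0 + se * DG)) => //.
- by rewrite mulr_gt0 // ltr_wpDr // divr_ge0 ?mulr_ge0 // subr_ge0 ltW.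
- by rewrite r0 ltW.
- by rewrite addr_ge0 ?mulr_ge0 // ltW.
- move=> j /th_init h; apply: le_trans h _.
  by rewrite lerDl mulr_ge0 // ltW.
Qed.

End Averaging.

(** * Feasibility *)

(** Bernoulli gives (1 - x)^m >= 1 - m x, and 1 / (1 - y) <= 1 + 2 y for 0 <= y <= 1/2. *)
Lemma bernoulli_inv (R : realType) (x : R) (m : nat) :
  0 <= x -> m%:R * x <= 1 / 2 -> x < 1 -> (1 - x) ^- m <= 1 + 2 * (m%:R * x).
Proof.
move=> x0 mx x1.
have b : 1 - m%:R * x <= (1 - x) ^+ m.
  elim: m {mx} => [|m IH]; first by rewrite expr0 mul0r subr0.
  rewrite exprSr; have : 0 <= 1 - x by lra.
  move=> /ler_wpM2r /(_ _ _ IH); apply: le_trans.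
  have : 0 <= m%:R * x * x by rewrite !mulr_ge0.
  by rewrite -natr1; lra.
have p : 0 < (1 - x) ^+ m by rewrite exprn_gt0 // subr_gt0.
have q : 0 <= m%:R * x by rewrite mulr_ge0.
rewrite -[leLHS]mul1r ler_pdivrMr //.
move: ((1 - x) ^+ m) (m%:R * x) b mx q p => z w; nra.
Qed.

Section Feasibility.
Context {R : realType} {n : nat}.
Variables (DM : nat) (a : 'cV[R]_n) (Hm HM sigma Q0 DQ sigma0 : R).
Hypotheses (n_gt0 : (0 < n)%N) (DM_gt0 : (0 < DM)%N) (a_gt0 : forall i, 0 < a i 0).
Hypotheses (Hm_gt0 : 0 < Hm) (HmM : Hm <= HM) (sigma_gt0 : 0 < sigma).
Hypothesis sigma0_ge0 : 0 <= sigma0.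

Let HM_gt0 : 0 < HM. Proof. exact: lt_le_trans Hm_gt0 HmM. Qed.
Let HM_ge0 : 0 <= HM. Proof. exact: ltW. Qed.
Let sigma_ge0 : 0 <= sigma. Proof. exact: ltW. Qed.

Local Notation r1 := (rho1 DM 1 a HM).
Local Notation r2 := (rho2 DM 1 a).
Local Notation r3 := (rho3 DM 1 a HM 1).
Local Notation r4 := (rho4 DM 1 a).
Let r1_ge0 : 0 <= r1. Proof. exact: (rho1_ge0 _ n_gt0 a_gt0 ltr01 Hm_gt0). Qed.
Let r2_ge0 : 0 <= r2. Proof. exact: (rho2_ge0 _ a_gt0 ltr01). Qed.
Let r3_ge0 : 0 <= r3. Proof. exact: (rho3_ge0 _ _ _ ltr01 Hm_gt0). Qed.
Let r4_ge0 : 0 <= r4. Proof. exact: (rho4_ge0 _ a_gt0 ltr01). Qed.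
Let A_ge0 : 0 <= normA a. Proof. exact: sqrtr_ge0. Qed.
Let B_ge0 : 0 <= normB a. Proof. exact: sqrtr_ge0. Qed.
Let D_ge1 : 1 <= DM%:R :> R. Proof. by rewrite ler1n. Qed.
Let D_ge0 : 0 <= DM%:R :> R. Proof. exact: ler0n. Qed.
Let sy_ge0 : 0 <= sigma_y a HM sigma.
Proof. by rewrite mulr_ge0 ?sqr_ge0 // divr_ge0. Qed.

(** Majorants left after one factor [k] has been taken out. In (c) [DeltaY] is divided by eps k Hm,
    so it must be O(k) for one threshold on eps to serve all k <= 1. The absolute value is there
    because the sign of [Q0 + DQ] is not fixed in this section. *)
Definition boundG : R :=
  r1 * sigma + r2 * `|Q0 + DQ| + r3 + r4 * sigma ^+ 2 * HM.
Definition boundDelta : R := 2 * (sigma_y a HM sigma + `|Q0 + DQ|) * normB a.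
Definition boundOut : R := 2 * DM%:R * HM * normB a * (sigma + normA a) *
  (boundDelta + 4 * pi * normA a * (2 * pi + 1)).
Definition boundY : R :=
  HM * boundG + r1 * (boundDelta + boundOut)
  + 2 * r4 * sigma * HM * (boundDelta + boundOut)
  + boundOut + r4 * HM * (boundDelta + boundOut) ^+ 2.

Lemma boundG_ge0 : 0 <= boundG.
Proof.
have h1 := mulr_ge0 r1_ge0 sigma_ge0.
have h2 := mulr_ge0 r2_ge0 (normr_ge0 (Q0 + DQ)).
have h4 := mulr_ge0 (mulr_ge0 r4_ge0 (sqr_ge0 sigma)) HM_ge0.
exact: (addr_ge0 (addr_ge0 (addr_ge0 h1 h2) r3_ge0) h4).
Qed.

Lemma boundDelta_ge0 : 0 <= boundDelta.
Proof. by rewrite !mulr_ge0 // addr_ge0. Qed.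

Lemma boundOut_ge0 : 0 <= boundOut.
Proof.
have h := boundDelta_ge0; rewrite mulr_ge0 //.
  by rewrite !mulr_ge0 // addr_ge0.
by rewrite addr_ge0 // !mulr_ge0 ?pi_ge0 // addr_ge0 // mulr_ge0 ?pi_ge0.
Qed.

Lemma boundY_ge0 : 0 <= boundY.
Proof.
have E0 := addr_ge0 boundDelta_ge0 boundOut_ge0.
have h1 := mulr_ge0 HM_ge0 boundG_ge0; have h2 := mulr_ge0 r1_ge0 E0.
have h3 := mulr_ge0 (mulr_ge0 (mulr_ge0 (mulr_ge0 (ler0n _ 2) r4_ge0) sigma_ge0)
  HM_ge0) E0.
have h4 := mulr_ge0 (mulr_ge0 r4_ge0 HM_ge0) (sqr_ge0 (boundDelta + boundOut)).
exact: (addr_ge0 (addr_ge0 (addr_ge0 (addr_ge0 h1 h2) h3) boundOut_ge0) h4).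
Qed.

Section SmallParameters.
Variables (k eps : R).
Hypotheses (k_gt0 : 0 < k) (k_le1 : k <= 1) (eps_gt0 : 0 < eps).
Hypothesis se_le : Num.sqrt eps <= 1 / 2.
Local Notation se := (Num.sqrt eps).

Let k_ge0 : 0 <= k. Proof. exact: ltW. Qed.
Let se_ge0 : 0 <= se. Proof. exact: sqrtr_ge0. Qed.

Lemma coef_c_le (i : 'I_n) : 0 <= coef_c DM eps i <= coef_c DM 1 i.
Proof.
apply/andP; split.
  apply: le_trans (coef_c_ge DM eps_gt0 i).
  by rewrite divr_ge0 // sqr_ge0.
rewrite /coef_c sqrtr1; set q := d3_3072 * pi * _.
have q0 : 0 < q by rewrite !mulr_gt0 // ?pi_gt0 // /d3_3072; lra.
have x0 : 0 <= n%:R * DM%:R :> R by rewrite mulr_ge0.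
have := se_le; have := se_ge0; move: (n%:R * DM%:R) x0 => x x0 s0 s1.
apply: lerD.
  rewrite ler_pM2r ?invr_gt0 //; nra.
rewrite ler_pM2r ?invr_gt0 // lerD2r; nra.
Qed.

Lemma DeltaG_le : DeltaG DM k a HM sigma Q0 DQ eps <= k * boundG.
Proof.
have e1 : rho1 DM k a HM = k * r1 by rewrite /rho1; ring.
have e2 : rho2 DM k a = k * r2 by rewrite /rho2; ring.
have e4 : rho4 DM k a = k * r4 by rewrite /rho4; ring.
have e3 : rho3 DM k a HM eps <= k * r3.
  rewrite /rho3 mul1r -!mulrA ler_wpM2l // ler_wpM2l // ler_wpM2l //.
    by apply: sumr_ge0 => i _; exact: sqr_ge0.
  apply: ler_wsqrtr; apply: ler_sum => i _.
  rewrite ler_pM2r ?invr_gt0 ?exprn_gt0 //.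
  by have /andP[h1 h2] := coef_c_le i; rewrite lerXn2r ?nnegrE // (le_trans h1).
have h2 := ler_wpM2l (mulr_ge0 k_ge0 r2_ge0) (ler_norm (Q0 + DQ)).
have -> : k * boundG = k * r1 * sigma + k * r2 * `|Q0 + DQ| + k * r3
    + k * r4 * sigma ^+ 2 * HM by rewrite /boundG; ring.
by rewrite /DeltaG e1 e2 e4 lerD // lerD // lerD.
Qed.

Lemma Delta_le : `|Delta k a HM sigma Q0 DQ| <= k * boundDelta.
Proof.
have -> : Delta k a HM sigma Q0 DQ =
  k * (2 * (sigma_y a HM sigma + (Q0 + DQ)) * normB a).
  by rewrite /Delta; ring.
rewrite normrM (ger0_norm k_ge0) ler_wpM2l // !normrM (ger0_norm B_ge0).
rewrite /boundDelta ler_wpM2r // (@ger0_norm _ 2) // ler_wpM2l //.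
by apply: le_trans (ler_normD _ _) _; rewrite (ger0_norm sy_ge0).
Qed.

Lemma DeltaOut_le : `|DeltaOut DM k a HM sigma Q0 DQ eps| <= k * boundOut.
Proof.
have K0 : 0 <= 2 * DM%:R * HM * normB a * (sigma + normA a).
  by rewrite !mulr_ge0 // addr_ge0.
pose v := ((1 - se) * DM%:R)^-1.
have v0 : 0 <= v <= 2.
  have s1 : 1 / 2 <= 1 - se by have := se_le; lra.
  have d1 := D_ge1; have m : 1 / 2 <= (1 - se) * DM%:R by nra.
  have m0 : 0 < (1 - se) * DM%:R by lra.
  apply/andP; split; first by rewrite invr_ge0 ltW.
  rewrite /v -[leRHS]invrK lef_pV2 ?posrE ?invr_gt0 //.
  by apply: le_trans m; lra.
have -> : DeltaOut DM k a HM sigma Q0 DQ eps =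
  k * (2 * DM%:R * HM * normB a * (sigma + normA a) *
   (se * Delta k a HM sigma Q0 DQ + 2 * pi * normA a * v * (pi * se * v + 1))).
  by rewrite /DeltaOut -/v; ring.
rewrite normrM (ger0_norm k_ge0) ler_wpM2l // normrM (ger0_norm K0).
rewrite /boundOut ler_wpM2l //.
apply: le_trans (ler_normD _ _) _; apply: lerD.
  rewrite normrM (ger0_norm se_ge0) -[leRHS]mul1r.
  apply: ler_pM => //; first by have := se_le; lra.
  apply: le_trans Delta_le _; rewrite ler_piMl // boundDelta_ge0 //.
have p0 := @pi_ge0 R; have /andP[v1 v2] := v0.
have psv : 0 <= pi * se * v <= 2 * pi.
  apply/andP; split; first by rewrite !mulr_ge0.
  rewrite mulrC; apply: ler_pM; rewrite ?mulr_ge0 //.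
  by rewrite ler_piMr //; have := se_le; lra.
rewrite ger0_norm; last by rewrite !mulr_ge0 // addr_ge0 // !mulr_ge0.
have w0 : 0 <= 2 * pi * normA a by rewrite !mulr_ge0.
apply: ler_pM; [exact: mulr_ge0|lra| |lra].
have -> : 4 * pi * normA a = 2 * pi * normA a * 2 by ring.
exact: ler_wpM2l.
Qed.

Lemma DeltaY_le : DeltaY DM k a HM sigma Q0 DQ eps <= k * boundY.
Proof.
have e1 : rho1 DM k a HM = k * r1 by rewrite /rho1; ring.
have e4 : rho4 DM k a = k * r4 by rewrite /rho4; ring.
have se1 : se <= 1 by have := se_le; lra.
have eps1 : eps <= 1.
  by rewrite -[leLHS]sqr_sqrtr ?(ltW eps_gt0) // exprn_ile1.
have G1 : DeltaG DM k a HM sigma Q0 DQ eps <= boundG.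
  by apply: le_trans DeltaG_le _; rewrite ler_piMl // boundG_ge0.
have d0 := boundDelta_ge0; have o0 := boundOut_ge0.
have D1 : `|Delta k a HM sigma Q0 DQ| <= boundDelta.
  by apply: le_trans Delta_le _; rewrite ler_piMl.
have O1 : `|DeltaOut DM k a HM sigma Q0 DQ eps| <= boundOut.
  by apply: le_trans DeltaOut_le _; rewrite ler_piMl.
have E1 : `|Delta k a HM sigma Q0 DQ
    + se * DeltaOut DM k a HM sigma Q0 DQ eps| <= boundDelta + boundOut.
  apply: le_trans (ler_normD _ _) _; apply: lerD => //.
  rewrite normrM (ger0_norm se_ge0) -[leRHS]mul1r.
  by apply: ler_pM.
rewrite /DeltaY /boundY e1 e4; set E := (_ + se * _) in E1 *.
have E2 : E ^+ 2 <= (boundDelta + boundOut) ^+ 2.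
  rewrite -[leLHS]real_normK ?num_real // lerXn2r ?nnegrE //.
  exact: addr_ge0.
(* The summand [DeltaOut] stands alone and must supply its own factor [k]; the other summands have
   [k] in their coefficients, so E and [DeltaG] are bounded without it. *)
have {}E1 := le_trans (ler_norm _) E1.
have {}O1 := le_trans (ler_norm _) DeltaOut_le.
have c1 := mulr_ge0 k_ge0 HM_ge0; have c2 := mulr_ge0 k_ge0 r1_ge0.
have c3 := mulr_ge0 (mulr_ge0 (mulr_ge0 (mulr_ge0 (ler0n R 2) k_ge0) r4_ge0) sigma_ge0) HM_ge0.
have c4 := mulr_ge0 (mulr_ge0 k_ge0 r4_ge0) HM_ge0.
have t4 : eps * E ^+ 2 <= 1 * (boundDelta + boundOut) ^+ 2.
  by apply: ler_pM; rewrite ?sqr_ge0 // ltW.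
have t := lerD (lerD (lerD (lerD (ler_wpM2l c1 G1) (ler_wpM2l c2 E1))
  (ler_wpM2l c3 E1)) O1) (ler_wpM2l c4 t4).
apply: le_trans (le_trans t _); rewrite le_eqVlt; apply/orP; left; apply/eqP; ring.
Qed.

Hypothesis se_Hm : se * (DM%:R * Hm) <= 1 / 2.

(** Everything beyond sigma0 is of order sqrt eps, with a factor free of [k]: the inverse power is 1
    + O(sqrt eps) because eps k Hm <= sqrt eps Hm, and in the last term both eps and [k] cancel. *)
Lemma condC_lhs_le :
  (sigma0 + se * DeltaG DM k a HM sigma Q0 DQ eps) * `|1 - eps * k * Hm| ^- DM
   + se * DeltaG DM k a HM sigma Q0 DQ eps
   + se ^+ 3 * DeltaY DM k a HM sigma Q0 DQ eps / (1 - `|1 - eps * k * Hm|)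
  <= sigma0 + se * (2 * (DM%:R * Hm) * (sigma0 + boundG)
      + 2 * boundG + boundY / Hm).
Proof.
have se_gt0 : 0 < se by rewrite sqrtr_gt0.
have se1 : se <= 1 by have := se_le; lra.
have se2 : se ^+ 2 = eps by rewrite sqr_sqrtr // ltW.
have G0 := boundG_ge0; have Y0 := boundY_ge0.
have G1 : DeltaG DM k a HM sigma Q0 DQ eps <= boundG.
  by apply: le_trans DeltaG_le _; rewrite ler_piMl.
have Y1 := DeltaY_le.
set x := eps * k * Hm.
have x0 : 0 < x by rewrite !mulr_gt0.
have xs : x <= se * Hm.
  rewrite /x -[X in X * k]se2 expr2 ler_wpM2r ?(ltW Hm_gt0) // -mulrA ler_piMr //.
  by rewrite mulr_ile1.
have Dx : DM%:R * x <= se * (DM%:R * Hm).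
  by rewrite [leRHS]mulrCA ler_wpM2l.
have xD : x <= DM%:R * x by rewrite ler_peMl // ltW.
have x1 : x < 1 by have := se_Hm; lra.
rewrite (ger0_norm (_ : 0 <= 1 - x)); last by rewrite subr_ge0 ltW.
have b := bernoulli_inv (ltW x0) (le_trans Dx se_Hm) x1.
have i0 : 0 <= (1 - x) ^- DM by rewrite invr_ge0 exprn_ge0 // subr_ge0 ltW.
have -> : se ^+ 3 * DeltaY DM k a HM sigma Q0 DQ eps / (1 - (1 - x))
   = se * (DeltaY DM k a HM sigma Q0 DQ eps / (k * Hm)).
  rewrite opprB addrC subrK; move: (DeltaY _ _ _ _ _ _ _ _) => Y.
  rewrite /x; move: se2 se_gt0; move: (Num.sqrt eps) => s <- s0.
  by field; rewrite !gt_eqF.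
have hY : DeltaY DM k a HM sigma Q0 DQ eps / (k * Hm) <= boundY / Hm.
  rewrite ler_pdivrMr ?mulr_gt0 //; apply: le_trans Y1 _.
  by rewrite le_eqVlt; apply/orP; left; apply/eqP; field; rewrite gt_eqF.
have h1 : (sigma0 + se * DeltaG DM k a HM sigma Q0 DQ eps) * (1 - x) ^- DM
    <= (sigma0 + se * boundG) * (1 + 2 * (se * (DM%:R * Hm))).
  apply: (@le_trans _ _ ((sigma0 + se * boundG) * (1 - x) ^- DM)).
    by rewrite ler_wpM2r // lerD2l ler_wpM2l.
  rewrite ler_wpM2l ?addr_ge0 ?mulr_ge0 //; apply: le_trans b _.
  by rewrite lerD2l ler_wpM2l.
have h2 := ler_wpM2l se_ge0 G1.
have h3 := ler_wpM2l se_ge0 hY.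
have h4 : se * (se * (DM%:R * Hm * boundG)) <= se * (DM%:R * Hm * boundG).
  by rewrite ler_wpM2l // ler_piMl // !mulr_ge0 // ltW.
move: h1 h2 h3 h4.
move: (DeltaG _ _ _ _ _ _ _ _) (DeltaY _ _ _ _ _ _ _ _ / _) (boundY / Hm) (_ ^- DM)
  => g y z w.
move: boundG => b1; lra.
Qed.

End SmallParameters.
End Feasibility.

Lemma feasible (R : realType) (n DM : nat) (a : 'cV[R]_n) (Hm HM Q0 DQ sigma0 : R) :
  (0 < n)%N -> (0 < DM)%N -> (forall i, 0 < a i 0) -> 0 < Hm -> Hm <= HM ->
  0 < sigma0 ->
  exists eps0 : R, 0 < eps0 /\ forall eps k : R, 0 < eps <= eps0 -> 0 < k <= 1 ->
    [/\ condA n DM eps, condB k Hm eps &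
        condC DM k a Hm HM (sigma0 + 1) Q0 DQ sigma0 eps].
Proof.
move=> n0 D0 a0 Hm0 HmM s00.
have sg : 0 < sigma0 + 1 by rewrite addr_gt0.
pose G := boundG DM a HM (sigma0 + 1) Q0 DQ.
pose Y := boundY DM a HM (sigma0 + 1) Q0 DQ.
have G0 : 0 <= G by exact: (boundG_ge0 _ _ _ n0 a0 Hm0).
have Y0 : 0 <= Y by exact: (boundY_ge0 _ _ _ n0 a0 Hm0).
pose K := 2 * (DM%:R * Hm) * (sigma0 + G) + 2 * G + Y / Hm.
have DH0 : 0 < DM%:R * Hm by rewrite mulr_gt0 // ltr0n.
have K0 : 0 <= K.
  have h1 : 0 <= 2 * (DM%:R * Hm) := mulr_ge0 (ler0n _ 2) (ltW DH0).
  have h2 := mulr_ge0 h1 (addr_ge0 (ltW s00) G0).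
  exact: (addr_ge0 (addr_ge0 h2 (mulr_ge0 (ler0n _ 2) G0)) (divr_ge0 Y0 (ltW Hm0))).
have nR : 1 <= n%:R :> R by rewrite ler1n.
have DR : 1 <= DM%:R :> R by rewrite ler1n.
(* With sqrt eps * N <= 1 each summand buys one inequality: [K] serves (c), [2 n + 1] serves (a),
   [2 DM Hm] gives (b) and the smallness required by [condC_lhs_le]; the last 1 is slack. *)
pose N := K + (2 * n%:R + 1) + 2 * (DM%:R * Hm) + 1.
have N0 : 0 < N by rewrite /N; lra.
exists (N ^- 2); split; first by rewrite invr_gt0 exprn_gt0.
move=> eps k /andP[eps0 epsN] /andP[k0 k1].
have s0 : 0 < Num.sqrt eps by rewrite sqrtr_gt0.
have sN : Num.sqrt eps * N <= 1.
  rewrite -ler_pdivlMr // mul1r.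
  rewrite -(@ler_pXn2r _ 2) ?nnegrE ?invr_ge0 ?(ltW N0) ?(ltW s0) //.
  by rewrite sqr_sqrtr ?(ltW eps0) // exprVn.
have se2 : Num.sqrt eps ^+ 2 = eps by rewrite sqr_sqrtr // ltW.
have sK : 0 <= Num.sqrt eps * K by rewrite mulr_ge0 // ltW.
have sD : 0 <= Num.sqrt eps * (DM%:R * Hm) by rewrite mulr_ge0 // ltW.
have sn : Num.sqrt eps <= Num.sqrt eps * n%:R by rewrite ler_peMr // ltW.
have sN' : Num.sqrt eps * K + 2 * (Num.sqrt eps * n%:R) + Num.sqrt eps
   + 2 * (Num.sqrt eps * (DM%:R * Hm)) + Num.sqrt eps <= 1.
  by move: sN; rewrite /N; lra.
have sH : Num.sqrt eps * Hm <= Num.sqrt eps * (DM%:R * Hm).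
  by rewrite ler_wpM2l ?(ltW s0) // ler_peMl // ltW.
have x1 : eps * k * Hm < 1.
  apply: (@le_lt_trans _ _ (Num.sqrt eps * Hm)); last by lra.
  rewrite -[X in X * k]se2 expr2 ler_wpM2r ?(ltW Hm0) // -mulrA ler_piMr ?(ltW s0) //.
  by rewrite mulr_ile1 ?(ltW s0) ?(ltW k0) //; lra.
split.
- rewrite /condA.
  have f : 2 * n%:Z + 1 <= floor_inv_sqrt eps.
    rewrite /floor_inv_sqrt floor_ge_int ler_pdivlMr // rmorphD rmorphM /=.
    by lra.
  apply: (le_trans f); rewrite ler_peMl //.
    by apply: le_trans f; rewrite addr_ge0.
  by rewrite -[leLHS]mulr1 ler_pM.
- by rewrite /condB; lra.
- split.
  + by rewrite subr_eq0 gt_eqF //; lra.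
  + by rewrite subr_eq0 gt_eqF.
  + apply: le_lt_trans (condC_lhs_le _ _ n0 D0 a0 Hm0 HmM sg (ltW s00) k0 k1 eps0 _ _) _;
      try lra.
    rewrite -/G -/Y -/K; lra.
Qed.

Theorem theorem2 (R : realType) (n DM : nat) (H : 'M[R]_n)
    (Hm HM sigma0 Q0 DQ : R) (a : 'cV[R]_n)
    (n_ge1 : (1 <= n)%N) (DM_ge1 : (1 <= DM)%N)
    (Hm_gt0 : 0 < Hm) (HM_gt0 : 0 < HM) (H_sym : H^T = H)
    (H_lower : loewner_le (Hm%:M) H) (H_upper : loewner_le H (HM%:M))
    (sigma0_gt0 : 0 < sigma0) (DQ_gt0 : 0 < DQ)
    (a_gt0 : forall i : 'I_n, 0 < a i 0) :
  (forall (theta_s center lo hi : 'cV[R]_n) (Qs k sigma eps_s : R),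
     enorm (theta_s - center) <= sigma0 ->
     (forall i : 'I_n, lo i 0 <= theta_s i 0 <= hi i 0) ->
     \sum_(i < n) (hi i 0 - lo i 0) ^+ 2 = sigma0 ^+ 2 ->
     `|Qs - Q0| <= DQ ->
     `|Qs| <= Q0 + DQ ->
     0 < k ->
     sigma0 < sigma ->
     0 < eps_s ->
     condA n DM eps_s ->
     condB k Hm eps_s ->
     condC DM k a Hm HM sigma Q0 DQ sigma0 eps_s ->
     forall eps : R, 0 < eps <= eps_s ->
     forall (D : nat -> nat) (th : nat -> 'cV[R]_n),
       (forall j : nat, (D j <= DM)%N) ->
       es_solution DM k a H Qs eps D th ->
       (forall j : nat, (j <= DM)%N -> enorm (th j) <= sigma0) ->
       (forall j : nat, (DM <= j)%N -> enorm (th j) < sigma) /\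
       exp_attracted th (Theta DM k a Hm HM sigma Q0 DQ eps_s eps)
         `|1 - eps * k * Hm|) /\
  (exists sigma : R, sigma0 < sigma /\
     exists eps0 k0 : R, [/\ 0 < eps0, 0 < k0 &
       forall eps_s k : R, 0 < eps_s <= eps0 -> 0 < k <= k0 ->
         [/\ condA n DM eps_s, condB k Hm eps_s &
             condC DM k a Hm HM sigma Q0 DQ sigma0 eps_s]]).
Proof.
have HmM : Hm <= HM := loewner_scalar_le H_lower H_upper n_ge1.
split.
  move=> _ _ _ _ Qs k sigma eps_s _ _ _ _ hQ k0 hs es0 hA hB hC eps.
  move=> /andP[eps0 epsle] D th hD hsol hinit; split.
    have [lt _ _] := es_bounds n_ge1 DM_ge1 a_gt0 Hm_gt0 H_sym H_lower H_upper
      sigma0_gt0 hQ k0 hs es0 hA hB hC eps0 epsle hD hsol hinit.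
    by move=> j _.
  exact: (es_attracted n_ge1 DM_ge1 a_gt0 Hm_gt0 H_sym H_lower H_upper
    sigma0_gt0 hQ k0 hs es0 hA hB hC eps0 epsle hD hsol hinit).
exists (sigma0 + 1); split; first by rewrite ltrDl.
have [e0 [e0_gt0 h]] := feasible Q0 DQ n_ge1 DM_ge1 a_gt0 Hm_gt0 HmM sigma0_gt0.
by exists e0, 1; split=> // eps_s k; exact: h.
Qed.
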